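(* Let $n\ge 3$ and let $F$ be an infinite field of characteristic $\neq 2$. Let $\mathrm{T}_n(F)$ be the group of invertible upper triangular $n\times n$ matrices over $F$. The quotient group $P\mathrm{T}_n(F)=\mathrm{T}_n(F)/Z(\mathrm{T}_n(F))$ is regularly bi-interpretable with the field $F$ with respect to the constants $\overline{\mathcal T^*}$, where $\overline{\mathcal T^*}$ is the tuple of images in $P\mathrm{T}_n(F)$, under the canonical epimorphism, of the elements of $\mathcal T^*=\{t_{ij}: 1\le i<j\le n\}\cup\{d_i: 1\le i\le n\}$.
   Context: $t_{ij}=I_n+e_{ij}$, where $e_{ij}$ is the matrix unit, and $d_i=\mathrm{diag}(1,\dots,1,-1,1,\dots,1)$ with $-1$ in position $i$. $Z(G)$ is the center of $G$. Interpretations. Let $\mathcal A,\mathcal B$ be first-order structures (groups in the language of groups, fields in the language of rings). An interpretation code $\Gamma$ (of $\mathcal A$ in $\mathcal B$) consists of first-order formulas in the language of $\mathcal B$, with designated parameter variables $\bar y$: a formula $U(\bar x,\bar y)$ (domain), a formula $E(\bar x,\bar x',\bar y)$ (equality), and one formula for each symbol of the language of $\mathcal A$. If, for a tuple $\bar p$ of $\mathcal B$, $E(\cdot,\cdot,\bar p)$ defines an equivalence relation on the set defined by $U(\cdot,\bar p)$ and the other formulas define on the quotient a structure in the language of $\mathcal A$, this structure is denoted $\Gamma(\mathcal B,\bar p)$. $\mathcal A$ is regularly interpretable in $\mathcal B$, written $\mathcal A\simeq\Gamma(\mathcal B,\varphi)$, if there are a code $\Gamma$ and a formula $\varphi(\bar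 y)$ in the language of $\mathcal B$, without parameters and satisfied by at least one tuple of $\mathcal B$, such that $\mathcal A\cong\Gamma(\mathcal B,\bar p)$ for every $\bar p$ with $\mathcal B\models\varphi(\bar p)$. $\mathcal A$ and $\mathcal B$ are regularly bi-interpretable if there are regular interpretations $\mathcal A\simeq\Gamma(\mathcal B,\varphi)$ and $\mathcal B\simeq\Delta(\mathcal A,\psi)$, a formula $\theta_{\mathcal A}$ in the language of $\mathcal A$ and a formula $\theta_{\mathcal B}$ in the language of $\mathcal B$ (both without constants) such that: for every $\bar q$ in $\mathcal A$ with $\mathcal A\models\psi(\bar q)$ and every tuple $\bar p$ of elements of $\mathcal A$ representing a tuple of $\Delta(\mathcal A,\bar q)$ that satisfies $\varphi$, the formula $\theta_{\mathcal A}(\cdot,\cdot,\bar p,\bar q)$ defines in $\mathcal A$ an isomorphism from $\mathcal A$ onto $\Gamma(\Delta(\mathcal A,\bar q),\bar p)$; and symmetrically for $\mathcal B$ with $\theta_{\mathcal B}$. ''With respect to the constants $\overline{\mathcal T^*}$'' means that the interpretation of $F$ in $P\mathrm{T}_n(F)$ uses as parameters tuples of the same length as $\overline{\mathcal T^*}$, and that $\overline{\mathcal T^*}$ is one of the admissible parameter tuples, i.e. it satisfies the formula that defines the set of admissible parameters in $P\mathrm{T}_n(F)$. *)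

(* Defs.v *)
From HB Require Import structures.
From mathcomp Require Import all_boot all_order all_algebra.
From mathcomp Require Import boolp classical_sets cardinality.

Set Implicit Arguments.
Unset Strict Implicit.
Unset Printing Implicit Defensive.

Import GRing.Theory.

Local Open Scope ring_scope.
Local Open Scope classical_set_scope.

(* Constants are function symbols of arity 0; relation symbols are left out,
   because the languages of groups and of rings have none besides equality. *)
Record language := Language {
  symbol :> Type;
  arity : symbol -> nat
}.

Record structure (L : language) := Structure {
  carrier :> Type;
  fun_interp : forall f : L, ('I_(arity f) -> carrier) -> carrier
}.

(* [V] is the type of variables.  In a tuple of variables such as
   [(x_0, ..., x_(d-1))] the variables are the elements of ['I_d], and a formula
   phi(x, y) in two tuples of variables is a formula over ['I_d + 'I_k]. *)
Inductive term (L : language) (V : Type) : Type :=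
| Var of V
| App (f : L) of ('I_(arity f) -> term L V).

(* Under a quantifier, [None] is the bound variable and [Some v] the variable
   [v] of the context. *)
Inductive formula (L : language) (V : Type) : Type :=
| Falsum
| Equal of term L V & term L V
| And of formula L V & formula L V
| Or of formula L V & formula L V
| Implies of formula L V & formula L V
| Forall of formula L (option V)
| Exists of formula L (option V).

Section Semantics.
Variables (L : language) (A : structure L).

Fixpoint eval (V : Type) (e : V -> A) (t : term L V) : A :=
  match t with
  | Var v => e v
  | App f ts => fun_interp (fun i => eval e (ts i))
  end.

Fixpoint holds (V : Type) (phi : formula L V) : (V -> A) -> Prop :=
  match phi with
  | Falsum => fun _ => False
  | Equal t u => fun e => eval e t = eval e u
  | And a b => fun e => holds a e /\ holds b e
  | Or a b => fun e => holds a e \/ holds b e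
  | Implies a b => fun e => holds a e -> holds b e
  | Forall a => fun e => forall x : A, holds a (oapp e x)
  | Exists a => fun e => exists x : A, holds a (oapp e x)
  end.

End Semantics.

Definition isomorphism (L : language) (A B : structure L) (h : A -> B) : Prop :=
  bijective h /\
  forall (f : L) (a : 'I_(arity f) -> A), h (fun_interp a) = fun_interp (h \o a).

Definition isomorphic (L : language) (A B : structure L) : Prop :=
  exists h : A -> B, isomorphism h.

Definition joint (V W M : Type) (e : V -> M) (e' : W -> M) (v : V + W) : M :=
  match v with inl x => e x | inr y => e' y end.

Notation "e '\with' e'" := (joint e e') (at level 50, left associativity).

(* Codes of [L]-structures in [K]-structures, with [k] parameters.  The last
   formula attached to [f] is the graph of [f]: its variables are the [arity f]
   tuples of arguments, the tuple of the value, and the parameters. *)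
Record code (L K : language) (k : nat) := Code {
  dim : nat;
  dom_formula : formula K ('I_dim + 'I_k);
  eq_formula : formula K ('I_dim + 'I_dim + 'I_k);
  sym_formula :
    forall f : L, formula K ('I_(arity f) * 'I_dim + 'I_dim + 'I_k)
}.

Section Interpretation.
Variables (L K : language) (k : nat) (Gamma : code L K k).
Variables (B : structure K) (p : 'I_k -> B).

Local Notation tup := ('I_(dim Gamma) -> B).

Definition code_dom : set tup :=
  [set x | holds (dom_formula Gamma) (x \with p)].

Definition code_eq (x y : tup) : Prop :=
  holds (eq_formula Gamma) (x \with y \with p).

Definition code_sym (f : L) (x : 'I_(arity f) -> tup) (y : tup) : Prop :=
  holds (sym_formula Gamma f) (uncurry x \with y \with p).

Definition code_class (x : tup) : set tup :=
  [set y | code_dom y /\ code_eq x y].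

Definition code_quotient : Type :=
  {C : set tup | exists2 x, code_dom x & C = code_class x}.

Definition represents (x : tup) (c : code_quotient) : Prop := sval c x.

(* The relation induced on the quotient by the formula attached to [f]. *)
Definition quotient_graph (f : L)
    (a : 'I_(arity f) -> code_quotient) (c : code_quotient) : Prop :=
  exists x y, [/\ forall i, represents (x i) (a i), represents y c
                & code_sym x y].

(* A symbol formula defines an operation on the quotient when it is compatible
   with [code_eq] and the relation it induces is the graph of a function. *)
Record well_defined : Prop := WellDefined {
  code_eq_refl : forall x, code_dom x -> code_eq x x;
  code_eq_sym : forall x y, code_dom x -> code_dom y ->
    code_eq x y -> code_eq y x;
  code_eq_trans : forall x y z, code_dom x -> code_dom y -> code_dom z ->
    code_eq x y -> code_eq y z -> code_eq x z;
  code_sym_congr : forall (f : L) (x x' : 'I_(arity f) -> tup) (y y' : tup),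
    (forall i, [/\ code_dom (x i), code_dom (x' i) & code_eq (x i) (x' i)]) ->
    [/\ code_dom y, code_dom y' & code_eq y y'] ->
    code_sym x y -> code_sym x' y';
  code_sym_graph : forall (f : L) (a : 'I_(arity f) -> code_quotient),
    exists! c, quotient_graph a c
}.

(* Gamma(B, p) *)
Definition interpreted (wd : well_defined) : structure L :=
  @Structure L code_quotient (fun f a => sval (cid (code_sym_graph wd a))).

End Interpretation.

(* A ~ Gamma(B, phi) *)
Definition regular_interpretation (L K : language) (k : nat) (A : structure L)
    (B : structure K) (Gamma : code L K k) (phi : formula K 'I_k) : Prop :=
  (exists p : 'I_k -> B, holds phi p) /\
  forall p : 'I_k -> B, holds phi p ->
    exists wd : well_defined Gamma p, isomorphic A (interpreted wd).

(* One formula theta(x, z, p, q) defines in A, for all q satisfying psi and all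
   p representing a tuple pc of Delta(A, q) that satisfies phi, an isomorphism of
   A onto Gamma(Delta(A, q), pc).  The elements of the latter are represented
   by tuples z of tuples of elements of A. *)
Definition definable_iso (L K : language) (m k : nat) (A : structure L)
    (Gamma : code L K m) (phi : formula K 'I_m)
    (Delta : code K L k) (psi : formula L 'I_k) : Prop :=
  exists theta : formula L (unit + 'I_(dim Gamma) * 'I_(dim Delta)
                            + 'I_m * 'I_(dim Delta) + 'I_k),
  forall q : 'I_k -> A, holds psi q ->
  forall (wdD : well_defined Delta q)
    (p : 'I_m -> 'I_(dim Delta) -> A) (pc : 'I_m -> interpreted wdD),
    (forall i, represents (p i) (pc i)) -> holds phi pc ->
  exists (wdG : well_defined Gamma pc) (h : A -> interpreted wdG),
    isomorphism h /\
    forall (x : A) (z : 'I_(dim Gamma) -> 'I_(dim Delta) -> A),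
      holds theta ((fun=> x) \with uncurry z \with uncurry p \with q) <->
      exists2 zc : 'I_(dim Gamma) -> interpreted wdD,
        forall i, represents (z i) (zc i) & represents zc (h x).

(* The parameters of the interpretation of B in A are tuples of the length of
   [c], and [c] itself is one of the admissible ones. *)
Definition regularly_bi_interpretable_wrt (L K : language) (k : nat)
    (A : structure L) (B : structure K) (c : 'I_k -> A) : Prop :=
  exists (m : nat) (Gamma : code L K m) (phi : formula K 'I_m)
         (Delta : code K L k) (psi : formula L 'I_k),
    [/\ regular_interpretation A B Gamma phi,
        regular_interpretation B A Delta psi,
        definable_iso A Gamma phi Delta psi,
        definable_iso B Delta psi Gamma phi
      & holds psi c].

Arguments regularly_bi_interpretable_wrt {L K k} A B c.

Inductive group_symbol := GMul | GInv | GOne.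

Definition group_language : language :=
  @Language group_symbol
    (fun f => match f with GMul => 2 | GInv => 1 | GOne => 0 end)%N.

Definition group_structure (G : groupType) : structure group_language :=
  @Structure group_language G (fun f =>
    match f return ('I_(@arity group_language f) -> G) -> G with
    | GMul => fun a => (a ord0 * a ord_max)%g
    | GInv => fun a => ((a ord0)^-1)%g
    | GOne => fun _ => 1%g
    end).

Inductive ring_symbol := RAdd | ROpp | RZero | RMul | ROne.

Definition ring_language : language :=
  @Language ring_symbol
    (fun f => match f with RAdd => 2 | ROpp => 1 | RZero => 0
                         | RMul => 2 | ROne => 0 end)%N.

Definition ring_structure (R : pzRingType) : structure ring_language :=
  @Structure ring_language R (fun f =>
    match f return ('I_(@arity ring_language f) -> R) -> R with
    | RAdd => fun a => a ord0 + a ord_max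
    | ROpp => fun a => - a ord0
    | RZero => fun _ => 0
    | RMul => fun a => a ord0 * a ord_max
    | ROne => fun _ => 1
    end).

Section CentralQuotient.
Variable G : groupType.
Local Open Scope group_scope.

Definition center : set G := [set z | forall g, commute z g].

Definition center_eqv (x y : G) : bool := `[< center (x^-1 * y) >].

Lemma center1 : center 1.
Proof. by move=> g; rewrite /commute mul1g mulg1. Qed.

Lemma centerM x y : center x -> center y -> center (x * y).
Proof. by move=> cx cy g; rewrite /commute -mulgA (cy g) mulgA (cx g) mulgA. Qed.

Lemma centerV x : center x -> center x^-1.
Proof.
by move=> cx g; apply: (mulgI x); rewrite mulVKg mulgA cx -mulgA mulgV mulg1.
Qed.

Lemma center_eqvP x y :
  reflect (exists2 z, center z & y = x * z) (center_eqv x y).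
Proof.
apply: (iffP (asboolP _)) => [cxy | [z cz ->]]; last by rewrite mulKg.
by exists (x^-1 * y) => //; rewrite mulVKg.
Qed.

Lemma center_eqv_refl : reflexive center_eqv.
Proof. by move=> x; apply/asboolP; rewrite mulVg; apply: center1. Qed.

Lemma center_eqv_impl x y : center_eqv x y -> center_eqv y x.
Proof.
move=> /center_eqvP[z cz ->]; apply/center_eqvP.
by exists z^-1; [exact: centerV | rewrite mulgK].
Qed.

Lemma center_eqv_sym : symmetric center_eqv.
Proof. by move=> x y; apply/idP/idP; apply: center_eqv_impl. Qed.

Lemma center_eqv_trans : transitive center_eqv.
Proof.
move=> y x z /center_eqvP[u cu ->] /center_eqvP[v cv ->]; apply/center_eqvP.
by exists (u * v); [exact: centerM | rewrite mulgA].
Qed.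

Canonical center_equiv :=
  EquivRel center_eqv center_eqv_refl center_eqv_sym center_eqv_trans.

Definition central_quotient := {eq_quot center_equiv}%qT.

HB.instance Definition _ := Choice.on central_quotient.
HB.instance Definition _ := EqQuotient.on central_quotient.

Local Open Scope quotient_scope.

Definition cquot (x : G) : central_quotient := \pi_central_quotient x.

Definition cquot_mul (a b : central_quotient) := cquot (repr a * repr b).
Definition cquot_inv (a : central_quotient) := cquot (repr a)^-1.

Lemma eq_cquot x z : center z -> cquot (x * z) = cquot x.
Proof.
by move=> cz; apply/eqmodP; apply: center_eqv_impl; apply/center_eqvP; exists z.
Qed.

Lemma repr_cquot x : exists2 z, center z & repr (cquot x) = x * z.
Proof. by apply/center_eqvP; apply/eqmodP; rewrite /cquot reprK. Qed.

Lemma cquot_ind (P : central_quotient -> Prop) :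
  (forall x, P (cquot x)) -> forall a, P a.
Proof. by move=> Px a; rewrite -[a]reprK; apply: Px. Qed.

Lemma cquotM x y : cquot_mul (cquot x) (cquot y) = cquot (x * y).
Proof.
rewrite /cquot_mul; have [z cz ->] := repr_cquot x.
have [t ct ->] := repr_cquot y.
rewrite -(mulgA x z) (mulgA z y) (cz y) -(mulgA y z) mulgA.
by apply: eq_cquot; apply: centerM.
Qed.

Lemma cquotV x : cquot_inv (cquot x) = cquot x^-1.
Proof.
rewrite /cquot_inv; have [z cz ->] := repr_cquot x.
by rewrite invgM (centerV cz) eq_cquot //; apply: centerV.
Qed.

Lemma cquot_mulA : associative cquot_mul.
Proof.
elim/cquot_ind=> x; elim/cquot_ind=> y; elim/cquot_ind=> z.
by rewrite !cquotM mulgA.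
Qed.

Lemma cquot_mul1 : left_id (cquot 1) cquot_mul.
Proof. by elim/cquot_ind=> x; rewrite cquotM mul1g. Qed.

Lemma cquot_mulr1 : right_id (cquot 1) cquot_mul.
Proof. by elim/cquot_ind=> x; rewrite cquotM mulg1. Qed.

Lemma cquot_mulV : left_inverse (cquot 1) cquot_inv cquot_mul.
Proof. by elim/cquot_ind=> x; rewrite cquotV cquotM mulVg. Qed.

Lemma cquot_mulrV : right_inverse (cquot 1) cquot_inv cquot_mul.
Proof. by elim/cquot_ind=> x; rewrite cquotV cquotM mulgV. Qed.

HB.instance Definition _ := isGroup.Build central_quotient
  cquot_mulA cquot_mul1 cquot_mulr1 cquot_mulV cquot_mulrV.

End CentralQuotient.

Section Triangular.
Variables (n : nat) (F : fieldType).

(* [is_trig_mx] means lower triangular. *)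
Definition upper_unit : pred 'M[F]_n :=
  fun A => is_trig_mx A^T && (A \in unitmx).

Lemma upper_unitP (A : 'M[F]_n) :
  reflect ((forall i j : 'I_n, (j < i)%N -> A i j = 0) /\ A \in unitmx)
          (upper_unit A).
Proof.
apply: (iffP andP) => -[+ uA]; last first.
  by move=> tA; split=> //; apply/is_trig_mxP => i j ij; rewrite mxE tA.
by move=> /is_trig_mxP tA; split=> // i j ij; rewrite -(tA j i ij) mxE.
Qed.

Lemma upper_unit1 : upper_unit 1%:M.
Proof.
apply/upper_unitP; split=> [i j ij|]; last exact: unitmx1.
by rewrite mxE -val_eqE gtn_eqF.
Qed.

Lemma upper_unitM A B : upper_unit A -> upper_unit B -> upper_unit (A *m B).
Proof.
move=> /upper_unitP[tA uA] /upper_unitP[tB uB]; apply/upper_unitP.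
split=> [i j ij|]; last by rewrite unitmx_mul uA.
rewrite mxE big1 // => k _; case: (ltnP k i) => [ki | ik].
  by rewrite tA // mul0r.
by rewrite tB ?mulr0 // (leq_trans ij).
Qed.

Lemma upper_unit_diag A i : upper_unit A -> A i i != 0.
Proof.
case/andP=> tA; rewrite unitmxE -det_tr (det_trig tA) unitfE => /prodf_neq0.
by move=> /(_ i isT); rewrite mxE.
Qed.

Lemma upper_unitV A : upper_unit A -> upper_unit (invmx A).
Proof.
move=> hA; have /upper_unitP[tA uA] := hA.
apply/upper_unitP; split=> [i j|]; last by rewrite unitmx_inv.
have [m] := ubnP (n - i)%N; elim: m i => // m IH i; rewrite ltnS => le_m ji.
have /matrixP/(_ i j) := mulmxV uA; rewrite !mxE -val_eqE (gtn_eqF ji) /=.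
rewrite (bigD1 i) //= big1 ?addr0 => [/eqP|k ki].
  by rewrite mulf_eq0 (negPf (upper_unit_diag i hA)) => /eqP.
case: (ltngtP k i) => [lt_ki|lt_ik|/val_inj eq_ki]; last by rewrite eq_ki eqxx in ki.
  by rewrite tA // mul0r.
rewrite IH ?mulr0 ?(ltn_trans ji) //.
by apply: leq_trans le_m; rewrite ltn_sub2l.
Qed.

Record triangular := Triangular {
  tri_val :> 'M[F]_n;
  tri_valP : upper_unit tri_val
}.

HB.instance Definition _ := [isSub for tri_val].
HB.instance Definition _ := [Choice of triangular by <:].

Definition tri_one : triangular := Triangular upper_unit1.
Definition tri_mul (A B : triangular) : triangular :=
  Triangular (upper_unitM (tri_valP A) (tri_valP B)).
Definition tri_inv (A : triangular) : triangular :=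
  Triangular (upper_unitV (tri_valP A)).

Lemma tri_unit (A : triangular) : tri_val A \in unitmx.
Proof. by have /andP[] := tri_valP A. Qed.

Lemma tri_mulA : associative tri_mul.
Proof. by move=> A B C; apply: val_inj; rewrite /= mulmxA. Qed.

Lemma tri_mul1 : left_id tri_one tri_mul.
Proof. by move=> A; apply: val_inj; rewrite /= mul1mx. Qed.

Lemma tri_mulr1 : right_id tri_one tri_mul.
Proof. by move=> A; apply: val_inj; rewrite /= mulmx1. Qed.

Lemma tri_mulV : left_inverse tri_one tri_inv tri_mul.
Proof. by move=> A; apply: val_inj; rewrite /= mulVmx // tri_unit. Qed.

Lemma tri_mulrV : right_inverse tri_one tri_inv tri_mul.
Proof. by move=> A; apply: val_inj; rewrite /= mulmxV // tri_unit. Qed.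

HB.instance Definition _ := isGroup.Build triangular
  tri_mulA tri_mul1 tri_mulr1 tri_mulV tri_mulrV.

Definition proj_triangular : groupType := central_quotient triangular.

Definition t_mx (ij : {ij : 'I_n * 'I_n | (ij.1 < ij.2)%N}) : 'M[F]_n :=
  1%:M + delta_mx (val ij).1 (val ij).2.

Definition d_mx (i : 'I_n) : 'M[F]_n :=
  diag_mx (\row_j (if j == i then -1 else 1)).

Lemma upper_unit_t ij : upper_unit (t_mx ij).
Proof.
have lt_ij := valP ij; rewrite /t_mx; case: (val ij) lt_ij => a b /= lt_ab {ij}.
have tri : is_trig_mx (1%:M + delta_mx a b : 'M[F]_n)^T.
  apply/is_trig_mxP => i j lt_ij; rewrite !mxE -val_eqE (gtn_eqF lt_ij) add0r.
  case: (j =P a) => //= ja; case: (i =P b) => //= ib.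
  by rewrite ib ja ltnNge ltnW in lt_ij.
apply/andP; split=> //; rewrite unitmxE -det_tr (det_trig tri) unitfE.
apply/prodf_neq0 => i _; rewrite !mxE eqxx.
case: (i =P a) => [->|]; last by rewrite addr0 oner_neq0.
by rewrite -val_eqE (ltn_eqF lt_ab) addr0 oner_neq0.
Qed.

Lemma upper_unit_d i : upper_unit (d_mx i).
Proof.
have tri : is_trig_mx (d_mx i)^T.
  by rewrite tr_diag_mx; apply/diag_mx_is_trig.
apply/andP; split=> //; rewrite unitmxE -det_tr (det_trig tri) unitfE.
apply/prodf_neq0 => j _; rewrite !mxE eqxx.
by case: ifP; rewrite ?oppr_eq0 oner_neq0.
Qed.

Definition t_elt ij : triangular := Triangular (upper_unit_t ij).
Definition d_elt i : triangular := Triangular (upper_unit_d i).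

Definition T_star : seq triangular := codom t_elt ++ codom d_elt.

Definition T_star_bar : seq proj_triangular := map (@cquot triangular) T_star.

End Triangular.

(* Main.v *)
Require Import Defs.
From mathcomp Require Import all_boot all_order all_algebra.
From mathcomp Require Import boolp classical_sets cardinality.
From mathcomp Require Import ring.

(** The centre of the triangular group consists of the scalar matrices, so every
    element of the quotient group [G] is the class of exactly one matrix [mat x]
    with upper left entry 1.  These normalised matrices, multiplied as matrices,
    interpret [G] in the field [F] without parameters ([matrix_code]).

    Conversely, write [tau s] for the class of [1 + s e_1n].  The [tau s] are
    exactly the commutators that commute with all commutators
    ([central_commutatorP]), so they form a definable subgroup, a copy of the
    additive group of [F].  Since [x (tau s) x^-1 = tau (s / x_nn)] when [x] is
    normalised ([tau_conj]), conjugations scale [s], and every nonzero scalar arises so; hence, once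
    some [tau u <> 1] is chosen as unit, multiplication in [F] is definable too: the conjugation that takes [tau u] to [tau (u s)] takes [tau (u s')]
    to [tau (u s s')] ([scaled_mul_tau]).  This is [centre_code], and it
    interprets [F] for every choice of the unit.

    The link between the two codes is a system of words.  If [q] is the tuple of
    the images of the [t_ij] and [d_i], the entries of [x] can be extracted one
    by one by group words: [t_1i ^ x] is [1 + e_1 (row i of x)], and a commutator
    with [t_jn] moves the [j]-th entry of such a row into the corner.  The first
    row and the last column need [d_1] and [d_n] instead, each of which costs a
    factor 2; squaring the other words evens this out, so that the word for the
    entry [x_ij] is [tau (4 x_ij)] throughout ([entry_word_star]).  Relative to
    the unit [tau 4] these are the entries of [mat x].

    It remains to choose the admissible parameter tuples.  The formula
    [coordinates] demands of [q] that its element at the place of [t_1n] be some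
    [tau b <> 1], and that the words define a multiplicative bijection of [G]
    onto the normalised matrices over the field coded by [centre_code] with
    parameters [q].  This is a first-order condition, the
    constants satisfy it, and for every [q] that satisfies it the words are the
    definable isomorphism of [G] onto the group of matrices over the field coded
    in it.  On the field side, the isomorphism takes [s] to [tau (u s)], a matrix
    whose entries are polynomials in [s] and in the parameters.

    No formula is written out: definability of a predicate in a fixed structure
    is an existence statement with closure properties ([definable]), and the
    quotients behind the codes are handled through maps from tuples to the coded
    structure ([decoding]). *)

Import GRing.Theory.

Local Set Implicit Arguments.
Local Unset Strict Implicit.
Local Unset Printing Implicit Defensive.

Local Open Scope ring_scope.
Local Open Scope classical_set_scope.

(** * Definable predicates *)

Section Substitution.
Variable L : language.

Fixpoint term_subst (V W : Type) (s : V -> term L W) (t : term L V) : term L W :=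
  match t with
  | Var v => s v
  | App f ts => App (fun i => term_subst s (ts i))
  end.

Definition subst_lift (V W : Type) (s : V -> term L W) (v : option V) :
    term L (option W) :=
  if v is Some v' then term_subst (fun w => Var L (Some w)) (s v')
  else Var L None.

Fixpoint formula_subst (V W : Type) (s : V -> term L W) (phi : formula L V) :
    formula L W :=
  match phi with
  | Falsum => Falsum L W
  | Equal t u => Equal (term_subst s t) (term_subst s u)
  | And a b => And (formula_subst s a) (formula_subst s b)
  | Or a b => Or (formula_subst s a) (formula_subst s b)
  | Defs.Implies a b => Defs.Implies (formula_subst s a) (formula_subst s b)
  | Forall a => Forall (formula_subst (subst_lift s) a)
  | Exists a => Exists (formula_subst (subst_lift s) a)
  end.

Variable A : structure L.

Lemma eval_subst V W (s : V -> term L W) (e : W -> A) t :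
  eval e (term_subst s t) = eval (fun v => eval e (s v)) t.
Proof. by elim: t => //= f ts IH; congr fun_interp; apply/funext. Qed.

Lemma eval_subst_lift V W (s : V -> term L W) (e : W -> A) x :
  (fun v => eval (oapp e x) (subst_lift s v)) = oapp (fun v => eval e (s v)) x.
Proof. by apply/funext => -[v|] //=; rewrite eval_subst. Qed.

Lemma holds_subst V W (s : V -> term L W) (phi : formula L V) (e : W -> A) :
  holds (formula_subst s phi) e <-> holds phi (fun v => eval e (s v)).
Proof.
elim: phi W s e => {V} //= [V t u|V a IHa b IHb|V a IHa b IHb|V a IHa b IHb
                           |V a IHa|V a IHa] W s e.
- by rewrite !eval_subst.
- by rewrite IHa IHb.
- by rewrite IHa IHb.
- by rewrite IHa IHb.
- by split=> H x; move: (H x); rewrite IHa eval_subst_lift.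
- by split=> -[x]; rewrite ?IHa => H; exists x; move: H;
    rewrite ?IHa eval_subst_lift.
Qed.

End Substitution.

Section Definable.
Variables (L : language) (A : structure L).

(** Formulas enter the definition of bi-interpretability only through their
    meaning in one structure.  So it is enough to know that a predicate has some
    formula; [formula_of] picks one. *)
Definition definable V (P : (V -> A) -> Prop) :=
  exists phi : formula L V, forall e, holds phi e <-> P e.

Definition term_definable V (f : (V -> A) -> A) :=
  exists t : term L V, forall e, eval e t = f e.

Definition formula_of V (P : (V -> A) -> Prop) (dP : definable P) : formula L V :=
  projT1 (cid dP).

Lemma formula_ofP V (P : (V -> A) -> Prop) (dP : definable P) e :
  holds (formula_of dP) e <-> P e.
Proof. exact: (projT2 (cid dP)). Qed.

Variable V : Type.
Implicit Types (P Q : (V -> A) -> Prop) (f g : (V -> A) -> A).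

Lemma tdef_var v : term_definable (fun e : V -> A => e v).
Proof. by exists (Var L v). Qed.

Lemma tdef_app (h : L) (fs : 'I_(arity h) -> (V -> A) -> A) :
  (forall i, term_definable (fs i)) ->
  term_definable (fun e => fun_interp (fun i => fs i e)).
Proof.
move=> /choice[ts tsP]; exists (App ts) => e /=.
by congr fun_interp; apply/funext.
Qed.

Lemma def_eq f g :
  term_definable f -> term_definable g -> definable (fun e => f e = g e).
Proof. by move=> [t tP] [u uP]; exists (Equal t u) => e /=; rewrite tP uP. Qed.

Lemma def_false : definable (fun _ : V -> A => False).
Proof. by exists (Falsum L V). Qed.

Lemma def_imp P Q : definable P -> definable Q -> definable (fun e => P e -> Q e).
Proof. by move=> [a aP] [b bP]; exists (Defs.Implies a b) => e /=; rewrite aP bP. Qed.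

Lemma def_not P : definable P -> definable (fun e => ~ P e).
Proof. by move=> dP; exact: (def_imp dP def_false). Qed.

Lemma def_true : definable (fun _ : V -> A => True).
Proof. by exists (Defs.Implies (Falsum L V) (Falsum L V)) => e /=; split. Qed.

Lemma def_and P Q : definable P -> definable Q -> definable (fun e => P e /\ Q e).
Proof. by move=> [a aP] [b bP]; exists (And a b) => e /=; rewrite aP bP. Qed.

Lemma def_or P Q : definable P -> definable Q -> definable (fun e => P e \/ Q e).
Proof. by move=> [a aP] [b bP]; exists (Or a b) => e /=; rewrite aP bP. Qed.

Lemma def_all (Q : (V -> A) -> A -> Prop) :
  definable (fun e : option V -> A => Q (fun v => e (Some v)) (e None)) ->
  definable (fun e => forall x, Q e x).
Proof.
move=> [a aP]; exists (Forall a) => e /=.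
by split=> H x; [exact: (iffLR (aP _) (H x)) | exact: (iffRL (aP (oapp e x)) (H x))].
Qed.

Lemma def_ex (Q : (V -> A) -> A -> Prop) :
  definable (fun e : option V -> A => Q (fun v => e (Some v)) (e None)) ->
  definable (fun e => exists x, Q e x).
Proof.
move=> [a aP]; exists (Exists a) => e /=; split=> -[x Hx]; exists x.
  exact: (iffLR (aP (oapp e x))).
exact: (iffRL (aP (oapp e x))).
Qed.

Lemma def_forall_fin (I : finType) (P : I -> (V -> A) -> Prop) :
  (forall i, definable (P i)) -> definable (fun e => forall i, P i e).
Proof.
move=> dP.
have [phi phiP] : definable (fun e => forall i, i \in enum I -> P i e).
  elim: (enum I) => [|j s [phi phiP]].
    by have [a aP] := def_true; exists a => e; rewrite aP.
  have [a aP] := dP j; exists (And a phi) => e /=; rewrite aP phiP.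
  split=> [[Pj Ps] i|H]; first by rewrite inE => /predU1P[->|/Ps].
  by split=> [|i si]; apply: H; rewrite inE ?eqxx ?si ?orbT.
exists phi => e; rewrite phiP.
by split=> H i; [apply: H; rewrite mem_enum | move=> _; apply: H].
Qed.

(** A condition on indices is decided outside of the logic: when it fails, the
    formula is a tautology. *)
Lemma def_guard (b : bool) P :
  (b -> definable P) -> definable (fun e => b -> P e).
Proof.
case: b => [/(_ isT)[a aP]|_].
  by exists a => e; rewrite aP; split=> [|/(_ isT)].
by have [a aP] := def_true; exists a => e; rewrite aP.
Qed.

End Definable.

(** Puts terms in the place of variables, so that a predicate need be shown
    definable at variables only. *)
Lemma def_subst L (A : structure L) V W (P : (V -> A) -> Prop)
    (r : V -> (W -> A) -> A) :
  definable P -> (forall v, term_definable (r v)) ->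
  definable (fun e => P (fun v => r v e)).
Proof.
move=> [phi phiP] /choice[s sP]; exists (formula_subst s phi) => e.
by rewrite holds_subst phiP; under eq_fun do rewrite sP.
Qed.

Lemma tdef_rename L (A : structure L) V W (f : (V -> A) -> A) (r : V -> W) :
  term_definable f -> term_definable (fun e : W -> A => f (fun v => e (r v))).
Proof.
move=> [u uP]; exists (term_subst (fun v => Var L (r v)) u) => e.
by rewrite eval_subst uP.
Qed.

Definition tuple_cons (T : Type) n (x : T) (y : 'I_n -> T) (i : 'I_n.+1) : T :=
  oapp y x (unlift ord0 i).

(** The coordinates of the tuple are bound one after the other, so the variables
    of the context grow with the induction. *)
Lemma def_all_tuple L (A : structure L) n V
    (Q : (V -> A) -> ('I_n -> A) -> Prop) :
  definable (fun e : V + 'I_n -> A => Q (fun v => e (inl v)) (fun i => e (inr i)))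
  -> definable (fun e => forall x, Q e x).
Proof.
elim: n V Q => [|n IH] V Q dQ.
  have [|a aP] := @def_subst _ A _ V _
    (fun v e => match v with
      | inl v => e v
      | inr i => match notF (ltn_ord (i : 'I_0)) with end
      end) dQ.
    by case=> [v|[]] //; apply: tdef_var.
  exists a => e; rewrite aP; split=> [H x|]; last exact.
  suff -> : x = fun i : 'I_0 => match notF (ltn_ord i) with end by [].
  by apply/funext => -[].
suff [a aP] : definable (fun e => forall x y, Q e (tuple_cons x y)).
  exists a => e; rewrite aP; split=> [H x|H x y]; last exact: H.
  have -> : x = tuple_cons (x ord0) (fun i => x (lift ord0 i)).
    by apply/funext => i; rewrite /tuple_cons; case: unliftP => [j|] ->.
  exact: H.
apply/def_all/IH.
have [|a aP] := @def_subst _ A _ (option V + 'I_n)%type _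
  (fun v e => match v with
    | inl v => e (inl (Some v))
    | inr i => tuple_cons (e (inl None)) (fun j => e (inr j)) i end) dQ.
  move=> [v|i]; first exact: tdef_var.
  by rewrite /tuple_cons; case: unlift => /= *; apply: tdef_var.
by exists a => e; rewrite aP.
Qed.

Lemma def_not_not L (A : structure L) V (P : (V -> A) -> Prop) :
  definable (fun e => ~ P e) -> definable P.
Proof.
by move=> /def_not[a aP]; exists a => e; rewrite aP; split=> [/contrapT|? []].
Qed.

Lemma def_ex_tuple L (A : structure L) n V
    (Q : (V -> A) -> ('I_n -> A) -> Prop) :
  definable (fun e : V + 'I_n -> A => Q (fun v => e (inl v)) (fun i => e (inr i)))
  -> definable (fun e => exists x, Q e x).
Proof.
(* The existential quantifier is the dual of the universal one. *)
move=> dQ; apply: def_not_not.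
have [a aP] := @def_all_tuple _ A n V (fun e x => ~ Q e x) (def_not dQ).
exists a => e; rewrite aP; split=> [H [x /H]//|H x Qx]; by case: H; exists x.
Qed.

(** * Codes and decodings *)

Lemma isomorphism_inv (L : language) (A B : structure L) (h : A -> B) :
  isomorphism h -> exists2 h' : B -> A, isomorphism h' & cancel h h' /\ cancel h' h.
Proof.
move=> [[h' hK h'K] hf]; exists h' => //; split; first by exists h.
move=> f b; apply: (can_inj hK); rewrite h'K hf; congr fun_interp.
by apply/funext => i /=; rewrite h'K.
Qed.

Lemma eval_isomorphism (L : language) (A B : structure L) (h : A -> B) :
  isomorphism h -> forall V (t : term L V) e, eval (h \o e) t = h (eval e t).
Proof.
move=> [_ hf] V t e; elim: t => //= f ts IH; rewrite hf.
by congr fun_interp; apply/funext.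
Qed.

(** The structures coded inside a structure are isomorphic to the familiar ones,
    not equal to them; truth is moved along these isomorphisms. *)
Lemma holds_isomorphism (L : language) (A B : structure L) (h : A -> B) :
  isomorphism h ->
  forall V (phi : formula L V) e, holds phi (h \o e) <-> holds phi e.
Proof.
move=> ih V phi; have [[h' hK h'K] _] := ih.
have lift W (e : W -> A) x : oapp (h \o e) (h x) = h \o oapp e x.
  by apply/funext => -[].
elim: phi => {V} //= [V t u|V a IHa b IHb|V a IHa b IHb|V a IHa b IHb
                           |V a IHa|V a IHa] e.
- rewrite !(eval_isomorphism ih).
  by split=> [/(can_inj hK)|->].
- by rewrite IHa IHb.
- by rewrite IHa IHb.
- by rewrite IHa IHb.
- split=> H x; first by rewrite -IHa -lift.
  by rewrite -[x]h'K lift IHa.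
- split=> -[x]; first by rewrite -[x]h'K lift IHa; exists (h' x).
  by exists (h x); rewrite lift IHa.
Qed.

Lemma joint_comp V W (M M' : Type) (h : M -> M') (e : V -> M) (e' : W -> M) :
  (h \o e) \with (h \o e') = h \o (e \with e').
Proof. by apply/funext => -[]. Qed.

Lemma code_dom_isomorphism (L K : language) k (Gamma : code L K k)
    (B B' : structure K) (h : B -> B') (p : 'I_k -> B) x :
  isomorphism h ->
  code_dom (Gamma := Gamma) (h \o p) (h \o x) <-> code_dom p x.
Proof. by move=> ih; rewrite /code_dom /= joint_comp; apply: holds_isomorphism. Qed.

Lemma group_isomorphism (H H' : groupType) (h : H -> H') :
  bijective h -> (forall x y : H, h (x * y)%g = (h x * h y)%g) ->
  isomorphism (A := group_structure H) (B := group_structure H') h.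
Proof.
move=> bh hM; have h1 : h 1%g = 1%g.
  by apply: (mulgI (h 1%g)); rewrite -hM !mulg1.
split=> // -[] a //=.
by apply: (mulgI (h (a ord0))); rewrite -hM !mulgV.
Qed.

(** A decoding describes the coded structure without its quotient: [g] sends a
    tuple to the element it stands for.  It is onto, the equality formula is its
    kernel, and the symbol formulas compute the operations through it. *)
Record decoding (L K : language) k (Gamma : code L K k) (B : structure K)
    (p : 'I_k -> B) (A : structure L) (g : ('I_(Defs.dim Gamma) -> B) -> A) : Prop :=
  Decoding {
    decoding_onto : forall a, exists2 x, code_dom p x & g x = a;
    decoding_eq : forall x y, code_dom p x -> code_dom p y ->
      code_eq p x y <-> g x = g y;
    decoding_sym : forall (f : L) (x : 'I_(arity f) -> 'I_(Defs.dim Gamma) -> B) y,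
      (forall i, code_dom p (x i)) -> code_dom p y ->
      code_sym p x y <-> g y = fun_interp (g \o x)
  }.

Section Decoding.
Variables (L K : language) (k : nat) (Gamma : code L K k).
Variables (B : structure K) (p : 'I_k -> B) (A : structure L).
Variable g : ('I_(Defs.dim Gamma) -> B) -> A.
Hypothesis dg : decoding p g.

Let fiber (a : A) : set ('I_(Defs.dim Gamma) -> B) :=
  [set x | code_dom p x /\ g x = a].

Let fiber_class x : code_dom p x -> code_class p x = fiber (g x).
Proof.
move=> dx; apply/seteqP; split=> y [dy].
  by move=> /(decoding_eq dg dx dy) ->.
by move=> /= gy; split=> //; apply/(decoding_eq dg).
Qed.

Let decode_fiber a : exists2 x, code_dom p x & fiber a = code_class p x.
Proof.
by have [x dx <-] := decoding_onto dg a; exists x => //; rewrite fiber_class.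
Qed.

Let quo a : code_quotient Gamma p := exist _ (fiber a) (decode_fiber a).

Let quo_onto c : exists a, c = quo a.
Proof.
case: c => C [x dx CE]; exists (g x); apply: eq_exist.
by rewrite CE fiber_class.
Qed.

Let quo_inj a b : quo a = quo b -> a = b.
Proof.
move=> /(congr1 sval) /= E.
have [x dx gx] := decoding_onto dg a.
by have : fiber a x by []; rewrite E => -[_]; rewrite gx.
Qed.

Let quo_graph (f : L) (a : 'I_(arity f) -> A) b :
  quotient_graph (quo \o a) (quo b) <-> b = fun_interp a.
Proof.
split.
  move=> [x [y [xa [/= dy gy] xy]]].
  rewrite -gy; apply/esym; have/(decoding_sym dg) -> // := xy; last first.
    by move=> i; have [] := xa i.
  by congr fun_interp; apply/funext => i /=; have [] := xa i.
move=> ->; have [y dy gy] := decoding_onto dg (fun_interp a).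
have /choice[x xP] i : exists x, code_dom p x /\ g x = a i.
  by have [x] := decoding_onto dg (a i); exists x.
exists x, y; split=> //; apply/(decoding_sym dg) => //.
  by move=> i; case: (xP i).
rewrite gy; congr fun_interp; apply/funext => i /=; by case: (xP i).
Qed.

Lemma decoding_well_defined : well_defined Gamma p.
Proof.
split.
- by move=> x dx; apply/(decoding_eq dg).
- by move=> x y dx dy /(decoding_eq dg dx dy) E; apply/(decoding_eq dg).
- move=> x y z dx dy dz /(decoding_eq dg dx dy) E /(decoding_eq dg dy dz) E'.
  by apply/(decoding_eq dg) => //; rewrite E.
- move=> f x x' y y' xx' [dy dy' /(decoding_eq dg dy dy') yy'].
  have dx i : code_dom p (x i) by case: (xx' i).
  have dx' i : code_dom p (x' i) by case: (xx' i).
  move=> /(decoding_sym dg dx dy) E; apply/(decoding_sym dg) => //.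
  rewrite -yy' E; congr fun_interp; apply/funext => i /=.
  by case: (xx' i) => d d' /(decoding_eq dg d d').
- move=> f a.
  have /choice[b bP] i : exists b, a i = quo b by apply: quo_onto.
  have -> : a = quo \o b by apply/funext.
  exists (quo (fun_interp b)); split; first exact/quo_graph.
  by move=> c; have [d ->] := quo_onto c; move/quo_graph ->.
Qed.

(** The isomorphism sends [a] to the fibre of [g] above [a]; the fibres are the
    classes of the quotient.  This determines the representatives of each
    element, which is how definable isomorphisms are specified. *)
Lemma decoding_isomorphism (wd : well_defined Gamma p) :
  exists h : A -> interpreted wd, isomorphism h /\
    forall x a, represents x (h a) <-> code_dom p x /\ g x = a.
Proof.
exists quo; split=> //; split.
  have /choice[quo' quo'K] := quo_onto.
  by exists quo' => // a; apply: quo_inj.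
move=> f a /=; have [b Eb] := quo_onto (sval (cid (code_sym_graph wd (quo \o a)))).
rewrite Eb; congr quo; apply/esym/quo_graph; rewrite -Eb.
by case: cid => c [].
Qed.

(** Different decodings of one code give different isomorphisms onto the coded
    structure.  The definable one is obtained from the obvious one by
    composition with an automorphism. *)
Lemma decoding_comp (A' : structure L) (h : A -> A') :
  isomorphism h -> decoding p (h \o g).
Proof.
move=> [bh hf]; have [h' hK h'K] := bh; split.
- move=> a; have [x dx gx] := decoding_onto dg (h' a).
  by exists x => //=; rewrite gx.
- move=> x y dx dy; rewrite (decoding_eq dg) //=.
  by split=> [->|/(can_inj hK)].
- move=> f x y dx dy; rewrite (decoding_sym dg) //=.
  have -> : (h \o g) \o x = h \o (g \o x) by [].
  by rewrite -hf; split=> [->|/(can_inj hK)].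
Qed.

(** A code is also used inside a coded structure [B'], which is only known up to
    isomorphism. *)
Lemma decoding_transfer (B' : structure K) (h : B -> B') (h' : B' -> B) :
  isomorphism h -> cancel h h' -> cancel h' h ->
  decoding (h \o p) (fun x : 'I_(Defs.dim Gamma) -> B' => g (h' \o x)).
Proof.
move=> ih hK h'K.
have E V (x : V -> B') : x = h \o (h' \o x) by apply/funext => v /=; rewrite h'K.
have E' V (x : V -> B) : h' \o (h \o x) = x by apply/funext => v /=; rewrite hK.
have dom x : code_dom (Gamma := Gamma) (h \o p) x <-> code_dom p (h' \o x).
  by rewrite [in X in X <-> _](E _ x); apply: code_dom_isomorphism.
split.
- move=> a; have [x dx gx] := decoding_onto dg a.
  by exists (h \o x); rewrite ?dom E'.
- move=> x y /dom dx /dom dy; rewrite -(decoding_eq dg) // /code_eq.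
  by rewrite [in X in X <-> _](E _ x) [in X in X <-> _](E _ y) !joint_comp
     holds_isomorphism.
- move=> f x y dx /dom dy.
  rewrite -(decoding_sym dg (x := fun i => h' \o x i)) //; last first.
    by move=> i; apply/dom.
  rewrite /code_sym [in X in X <-> _](E _ (uncurry x)) [in X in X <-> _](E _ y).
  rewrite !joint_comp holds_isomorphism //.
  by rewrite -joint_comp; suff -> : h' \o uncurry x = uncurry (fun i => h' \o x i) by [];
    apply/funext => -[].
Qed.
End Decoding.

(** * Normalised matrices *)

Lemma mulmx_deltaE (R : pzSemiRingType) n (A : 'M[R]_n) (i j k l : 'I_n) :
  (A *m delta_mx i j) k l = A k i * (l == j)%:R.
Proof.
rewrite mxE (bigD1 i) //= big1 => [|s /negPf si]; first by rewrite mxE eqxx addr0.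
by rewrite mxE si mulr0.
Qed.

Lemma delta_mulmxE (R : pzSemiRingType) n (A : 'M[R]_n) (i j k l : 'I_n) :
  (delta_mx i j *m A) k l = (k == i)%:R * A j l.
Proof.
rewrite mxE (bigD1 j) //= big1 => [|s /negPf sj]; first by rewrite mxE eqxx andbT addr0.
by rewrite mxE sj andbF mul0r.
Qed.

Definition central_commutator (H : groupType) (z : H) : Prop :=
  ((exists a b, z = [~ a, b]) /\ forall a b, z * [~ a, b] = [~ a, b] * z)%g.

Lemma commg_eq (H : groupType) (a b z : H) : (a * b = b * a * z -> [~ a, b] = z)%g.
Proof. by move=> E; rewrite /commg /conjg E -mulgA mulKg mulKg. Qed.

Section Model.
Variables (m : nat) (F : fieldType).
Hypothesis F2 : 2%N \notin [pchar F].

Local Notation n := m.+2.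
Local Notation last := (ord_max : 'I_n).
Local Notation first := (ord0 : 'I_n).
Local Notation G := (proj_triangular n F).
Implicit Types (A B : 'M[F]_n) (a b x z : G).

Let two_neq0 : 2 != 0 :> F.
Proof. by move: F2; rewrite inE. Qed.

Let last_neq0 : last != first. Proof. by []. Qed.

Definition upper A := forall i j : 'I_n, (j < i)%N -> A i j = 0.

(** [A e_ij] is column [i] of [A] moved to column [j], and [e_ij A] is row [j]
    of [A] moved to row [i]. *)
Lemma comm_delta A i j : A *m delta_mx i j = delta_mx i j *m A ->
  [/\ forall k, k != i -> A k i = 0, A i i = A j j
    & forall k, k != j -> A j k = 0].
Proof.
move=> /matrixP E; split=> [k /negPf ki||k /negPf kj].
- by have := E k j; rewrite mulmx_deltaE delta_mulmxE ki eqxx mulr1 mul0r.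
- by have := E i j; rewrite mulmx_deltaE delta_mulmxE !eqxx mulr1 mul1r.
- by have := E i k; rewrite mulmx_deltaE delta_mulmxE kj eqxx mulr0 mul1r.
Qed.

(** By [comm_delta], every column that is not the last and every row that is not
    the first vanishes off the diagonal; what is left is the corner. *)
Lemma comm_unipotent A :
  (forall i j : 'I_n, (i < j)%N -> A *m delta_mx i j = delta_mx i j *m A) ->
  A = (A first first)%:M + A first last *: delta_mx first last.
Proof.
move=> H; have cA (i j : 'I_n) (ij : (i < j)%N) := comm_delta (H i j ij).
apply/matrixP => i j; rewrite !mxE.
have [->|ij] := eqVneq i j.
  have -> : (j == first) && (j == last) = false.
    by apply/negP => /andP[/eqP->]; rewrite eq_sym.
  rewrite mulr0 addr0 mulr1n; have [->//|j0] := eqVneq j first.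
  by have [] := cA first j; rewrite ?lt0n.
rewrite mulr0n add0r; case: (eqVneq j last) ij => [->|jl] ij; last first.
  rewrite andbF mulr0.
  have [|+ _ _] := cA j last; last by apply.
  by rewrite /= ltn_neqAle jl -ltnS ltn_ord.
have [-> /=|i0] := eqVneq i first; first by rewrite mulr1.
rewrite mulr0; have [|_ _] := cA first i; first by rewrite lt0n.
by move/(_ last) => -> //; rewrite eq_sym.
Qed.

Lemma upper_unitE A : upper_unit A <-> upper A /\ forall i, A i i != 0.
Proof.
split=> [hA|[tA dA]].
  by split=> [|i]; [case/upper_unitP: hA | apply: upper_unit_diag].
apply/upper_unitP; split=> //; rewrite unitmxE -det_tr det_trig; last first.
  by apply/is_trig_mxP => i j ij; rewrite mxE tA.
by rewrite unitfE; apply/prodf_neq0 => i _; rewrite mxE.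
Qed.

(** The representatives modulo scalars. *)
Definition normal A := [/\ upper A, forall i, A i i != 0 & A first first = 1].

Definition normalize A := (A first first)^-1 *: A.

Lemma normal_unit A : normal A -> upper_unit A.
Proof. by case=> *; apply/upper_unitE. Qed.

Lemma normalizeK A : A first first = 1 -> normalize A = A.
Proof. by rewrite /normalize => ->; rewrite invr1 scale1r. Qed.

Lemma normalize_normal A : upper_unit A -> normal (normalize A).
Proof.
move=> /upper_unitE[tA dA]; split=> [i j ij|i|]; rewrite mxE.
- by rewrite (tA i j ij) mulr0.
- by rewrite mulf_neq0 // invr_eq0.
- by rewrite mulVf.
Qed.

Lemma upper_diagM A B i : upper A -> upper B -> (A *m B) i i = A i i * B i i.
Proof.
move=> tA tB; rewrite mxE (bigD1 i) //= big1 ?addr0 // => k ki.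
case: (ltngtP k i) => [lt|gt|/val_inj E]; last by rewrite E eqxx in ki.
  by rewrite tA // mul0r.
by rewrite tB // mulr0.
Qed.

Lemma normalizeM A B : upper_unit A -> upper_unit B ->
  normalize (A *m B) = normalize A *m normalize B.
Proof.
move=> /upper_unitE[tA dA] /upper_unitE[tB dB].
rewrite /normalize upper_diagM // invfM -scalemxAr -scalemxAl scalerA mulrC.
by rewrite [X in X *: _]mulrC.
Qed.

Definition eq_elt (A : 'M[F]_n) : G := cquot (insubd (1%g : triangular n F) A).

(** Locked, so that computing an entry stops at [mat a i j]. *)
Definition mat (a : G) : 'M[F]_n := locked (normalize (repr a : triangular n F)).

Lemma d_mxE i : d_mx F i = 1%:M - 2 *: delta_mx i i :> 'M[F]_n.
Proof.
apply/matrixP => j k; rewrite !mxE; have [->|jk] := eqVneq j k.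
  rewrite andbb mulr1n; case: eqVneq => _; last by rewrite mulr0 subr0.
  by rewrite mulr1 opprD addNKr.
have -> : (j == i) && (k == i) = false.
  by apply/negP => /andP[/eqP ji /eqP ki]; rewrite ji ki eqxx in jk.
by rewrite mulr0 subrr.
Qed.

(** By [comm_unipotent], a central matrix is a scalar plus a multiple of the
    corner; the first sign matrix negates the corner, which must then be 0 since
    2 is invertible. *)
Lemma center_scalar (z : triangular n F) :
  center z <-> exists c, tri_val z = c%:M.
Proof.
split=> [cz|[c zE] g]; last first.
  by apply: val_inj; rewrite /= zE scalar_mxC.
have cE (g : triangular n F) : tri_val z *m g = tri_val g *m z.
  by have /(congr1 val) := cz g.
have zE : tri_val z =
    (tri_val z first first)%:M + tri_val z first last *: delta_mx first last.
  apply: comm_unipotent => i j ij.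
  have /= := cE (t_elt F (exist _ (i, j) ij)).
  by rewrite /t_mx /= mulmxDr mulmxDl mulmx1 mul1mx => /addrI.
have z0 : tri_val z first last = 0.
  have := cE (d_elt F first); rewrite /= d_mxE mulmxBr mulmxBl mulmx1 mul1mx.
  move=> /addrI/oppr_inj; rewrite -scalemxAr -scalemxAl.
  move=> /(scalerI two_neq0)/matrixP/(_ first last).
  by rewrite mulmx_deltaE delta_mulmxE mulr0 mul1r.
by exists (tri_val z first first); rewrite zE z0 scale0r addr0 !mxE.
Qed.

Lemma mat_cquot (A : triangular n F) : mat (cquot A) = normalize A.
Proof.
rewrite /mat -lock; have [z /center_scalar[c zE] ->] := repr_cquot A.
rewrite /= zE mul_mx_scalar /normalize mxE invfM scalerA -mulrA mulrCA mulVf ?mulr1 //.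
have /upper_unitE[_ /(_ first)] := tri_valP z.
by rewrite zE mxE.
Qed.

Lemma mat_normal a : normal (mat a).
Proof. by rewrite /mat -lock; apply/normalize_normal/tri_valP. Qed.

Lemma eq_eltK A : normal A -> mat (eq_elt A) = A.
Proof.
move=> nA; rewrite mat_cquot insubdK; last exact: normal_unit.
by apply: normalizeK; case: nA.
Qed.

(** Triangular matrices with the same normalisation differ by a scalar, hence
    by a central element. *)
Lemma mat_inj : injective mat.
Proof.
elim/cquot_ind=> A; elim/cquot_ind=> B; rewrite !mat_cquot => E.
have [dA dB] : A first first != 0 /\ B first first != 0.
  by have [[_ dA] [_ dB]] := (iffLR (upper_unitE _) (tri_valP A),
                             iffLR (upper_unitE _) (tri_valP B)).
have BE : tri_val B = (B first first / A first first) *: tri_val A.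
  by rewrite -scalerA -[_ *: tri_val A]/(normalize A) E scalerA mulfV // scale1r.
rewrite -[B in RHS](mulVKg A); apply/esym/eq_cquot/center_scalar.
exists (B first first / A first first).
by rewrite /= [in LHS]BE -scalemxAr mulVmx ?tri_unit // scalemx1.
Qed.

Lemma matK : cancel mat eq_elt.
Proof. by move=> a; apply: mat_inj; rewrite eq_eltK //; apply: mat_normal. Qed.

Lemma matM a b : mat (a * b)%g = mat a *m mat b.
Proof.
elim/cquot_ind: a => A; elim/cquot_ind: b => B.
have -> : (cquot A * cquot B)%g = cquot (A * B)%g by apply: cquotM.
by rewrite !mat_cquot normalizeM //; apply: tri_valP.
Qed.

Lemma mat1 : mat 1%g = 1%:M.
Proof. by rewrite mat_cquot normalizeK //= mxE. Qed.

Lemma normalM A B : normal A -> normal B -> normal (A *m B).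
Proof. by move=> /eq_eltK<- /eq_eltK<-; rewrite -matM; apply: mat_normal. Qed.

Lemma eq_eltM A B : normal A -> normal B -> eq_elt (A *m B) = (eq_elt A * eq_elt B)%g.
Proof.
by move=> nA nB; apply: mat_inj; rewrite matM !eq_eltK //; apply: normalM.
Qed.

Definition elem (i j : 'I_n) s : G := eq_elt (1%:M + s *: delta_mx i j).

Definition tau s : G := elem first last s.

Lemma normal_elem (i j : 'I_n) s : (i < j)%N -> normal (1%:M + s *: delta_mx i j).
Proof.
move=> ij; have Nij (u v : 'I_n) : (v <= u)%N -> (u == i) && (v == j) = false.
  by move=> vu; apply/negP => /andP[/eqP ui /eqP vj]; move: vu; rewrite ui vj leqNgt ij.
split=> [u v vu|u|]; rewrite !mxE.
- by rewrite Nij ?mulr0 ?addr0 1?ltnW // -val_eqE gtn_eqF.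
- by rewrite Nij // mulr0 addr0 eqxx oner_neq0.
- by rewrite Nij // mulr0 addr0 eqxx.
Qed.

Lemma mat_elem (i j : 'I_n) s : (i < j)%N -> mat (elem i j s) = 1%:M + s *: delta_mx i j.
Proof. by move=> ij; rewrite eq_eltK //; apply: normal_elem. Qed.

Lemma mat_tau s : mat (tau s) = 1%:M + s *: delta_mx first last.
Proof. exact: mat_elem. Qed.

Lemma normal_col0 A p (j : 'I_p) : normal A -> A *m delta_mx first j = delta_mx first j.
Proof.
case=> tA _ A0; apply/matrixP => u v; rewrite mxE (bigD1 first) //= big1.
  rewrite addr0 !mxE eqxx /=; have [->|u0] := eqVneq u first; first by rewrite A0 mul1r.
  by rewrite tA ?mul0r // lt0n.
by move=> s /negPf s0; rewrite mxE s0 mulr0.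
Qed.

Lemma upper_row_last A : upper A ->
  delta_mx first last *m A = A last last *: delta_mx first last.
Proof.
move=> tA; apply/matrixP => u v; rewrite delta_mulmxE !mxE.
have [->|vl] := eqVneq v last; first by rewrite andbT mulrC.
by rewrite andbF !mulr0 tA ?mulr0 // ltn_neqAle vl -ltnS ltn_ord.
Qed.

Lemma tauD s s' : tau (s + s') = (tau s * tau s')%g.
Proof.
apply: mat_inj; rewrite matM !mat_tau mulmxDr mulmx1 -scalemxAr normal_col0.
  by rewrite scalerDl addrA.
exact: normal_elem.
Qed.

Lemma tau0 : tau 0 = 1%g.
Proof. by apply: mat_inj; rewrite mat_tau scale0r addr0 mat1. Qed.

Lemma tauN s : tau (- s) = ((tau s)^-1)%g.
Proof. by apply: (mulgI (tau s)); rewrite -tauD subrr mulgV tau0. Qed.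

Definition coef a : F := mat a first last.

Lemma tauK : cancel tau coef.
Proof.
by move=> s; rewrite /coef mat_tau !mxE !eqxx mulr1 eq_sym (negPf last_neq0) add0r.
Qed.

Lemma tauX s k : (tau s ^+ k)%g = tau (s *+ k).
Proof.
elim: k => [|k IH]; first by rewrite mulr0n tau0 expg0.
by rewrite expgS IH -tauD mulrS.
Qed.

Lemma tau_prod (I : Type) (r : seq I) (f : I -> F) :
  (\prod_(i <- r) tau (f i))%g = tau (\sum_(i <- r) f i).
Proof.
by apply/esym; elim/big_ind2: _ => [|s a s' b <- <-|]; rewrite ?tau0 ?tauD.
Qed.

(** [x (e_1n) = e_1n] because [x] is normalised, and [e_1n x = x_nn e_1n]. *)
Lemma tau_conj a s s' : (a * tau s = tau s' * a)%g <-> s = s' * mat a last last.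
Proof.
have -> : (a * tau s = tau s' * a)%g <->
    s *: delta_mx first last = (s' * mat a last last) *: delta_mx first last :> 'M[F]_n.
  have [tA _ _] := mat_normal a.
  split=> [/(congr1 mat)|E]; [|apply: mat_inj];
    rewrite !matM !mat_tau mulmxDr mulmxDl mulmx1 mul1mx -scalemxAr normal_col0
      -?scalemxAl ?upper_row_last ?scalerA //; try exact: mat_normal.
    by move=> /addrI.
  by rewrite E.
split=> [/matrixP/(_ first last)|-> //].
by rewrite !mxE !eqxx !mulr1.
Qed.

Lemma mat_comm_diag a b i : mat [~ a, b]%g i i = 1.
Proof.
have : (a * b = b * a * [~ a, b])%g by rewrite -commgC.
move: [~ a, b]%g => c /(congr1 mat)/matrixP/(_ i i).
have [[ta da _] [tb db _] [tc _ _]] := And3 (mat_normal a) (mat_normal b) (mat_normal c).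
have tba : upper (mat b *m mat a) by rewrite -matM; case: (mat_normal (b * a)%g).
rewrite !matM !upper_diagM // [mat b i i * _]mulrC.
by rewrite -[LHS]mulr1 => /mulfI <- //; rewrite mulf_neq0.
Qed.

Lemma normal_sign i : i != first -> normal (1%:M - 2 *: delta_mx i i).
Proof.
move=> i0; split=> [u v vu|u|]; rewrite !mxE.
- have uv : u == v = false by rewrite -val_eqE gtn_eqF.
  have -> : (u == i) && (v == i) = false.
    by apply/negP => /andP[/eqP ui /eqP vi]; rewrite ui vi eqxx in uv.
  by rewrite uv mulr0 subrr.
- rewrite eqxx andbb; case: (u == i); last by rewrite mulr0 subr0 oner_neq0.
  by rewrite mulr1 opprD addNKr oppr_eq0 oner_neq0.
- by rewrite eqxx andbb eq_sym (negPf i0) mulr0 subr0.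
Qed.

(** Conjugation by the sign matrix [1 - 2 e_jj] negates [e_ij], so the commutator
    with it doubles the coefficient of [e_ij]. *)
Lemma elem_commutator (i j : 'I_n) s : (i < j)%N ->
  exists a b : G, elem i j s = [~ a, b]%g.
Proof.
move=> ij; have j0 : j != first by rewrite -lt0n (leq_trans _ ij).
exists (eq_elt (1%:M - 2 *: delta_mx j j)), (elem i j (s / 2)).
apply/esym/commg_eq/mat_inj.
rewrite !matM eq_eltK ?mat_elem //; last exact: normal_sign.
set D := 1%:M - _; set E := delta_mx i j.
have [ij0 ji0] : i == j = false /\ j == i = false.
  by rewrite -!val_eqE ltn_eqF // gtn_eqF.
have DE : D *m E = E.
  by rewrite mulmxBl mul1mx -scalemxAl mul_delta_mx_cond ji0 mulr0n scaler0 subr0.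
have ED : E *m D = - E.
  rewrite mulmxBr mulmx1 -scalemxAr mul_delta_mx -/E scaler_nat mulr2n opprD.
  by rewrite addrA subrr sub0r.
have EE : E *m E = 0 by rewrite mul_delta_mx_cond ji0.
clearbody D E; rewrite mulmxDr (mulmxDl _ _ D) mulmx1 mul1mx mulmxDl !mulmxDr !mulmx1.
rewrite -!(scalemxAr, scalemxAl) ED DE mulNmx EE oppr0 !scaler0 addr0.
(* The commutator relation reduces to [s - s / 2 = s / 2]. *)
have sE : s / 2 + s / 2 = s by rewrite -mulr2n -[LHS]mulr_natr divfK.
by rewrite -{2}sE scalerN -addrA scalerDl addrK.
Qed.

(** Commutators have diagonal 1, and all [1 + e_ij] with [i < j] are commutators;
    so an element that is a commutator and commutes with all commutators is
    covered by [comm_unipotent].  No parameters occur in the condition. *)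
Lemma central_commutatorP z : central_commutator z <-> exists s, z = tau s.
Proof.
split=> [[[a0 [b0 zE]] cz]|[s ->]]; last first.
  split=> [|a b]; first exact: elem_commutator.
  apply: mat_inj; move: (mat_comm_diag a b) (mat_normal [~ a, b]%g).
  rewrite matM [RHS]matM; move: (mat [~ a, b]%g) => C dC nC.
  rewrite mat_tau mulmxDl mulmxDr mul1mx mulmx1 -scalemxAl -scalemxAr.
  by rewrite normal_col0 // upper_row_last ?dC ?scale1r //; case: nC.
exists (coef z); apply: mat_inj; rewrite mat_tau.
rewrite [LHS]comm_unipotent => [|i j ij]; first by case: (mat_normal z) => _ _ ->.
have [a [b eE]] := elem_commutator 1 ij.
have := cz a b; rewrite -eE => /(congr1 mat).
by rewrite !matM mat_elem // scale1r mulmxDl mulmxDr mul1mx mulmx1 => /addrI.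
Qed.

End Model.

(** * Words for the entries of a matrix *)

(** Group words in a tuple [q] of parameters, read through two maps [t] and [d]
    that locate the constants [t_ij] and [d_i] in the tuple. *)
Section Words.
Variables (H : groupType) (k n' : nat).
Local Notation n := n'.+1.
Variables (t : 'I_n -> 'I_n -> 'I_k) (d : 'I_n -> 'I_k).
Implicit Types (q : 'I_k -> H) (x w : H).
Local Open Scope group_scope.

Definition corner q : H := q (t ord0 ord_max).

(** The exponent is the factor by which the words below multiply the entries. *)
Definition unit_word q : H := corner q ^+ 4.

(** At the constants this is [1 + 2 e_1 (row i of x)], without the diagonal entry
    in the case of the first row.  Since [x] fixes [e_1], conjugating [t_1i] by
    [x] gives [1 + e_1 (row i of x)].  There is no [t_11], so the first row is
    taken from [d_1 = 1 - 2 e_11]; its factor 2 is the reason for the square. *)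
Definition row_word q x (i : 'I_n) : H :=
  if i == ord0 then [~ q (d ord0), x] else (q (t ord0 i) ^ x) ^+ 2.

(** For [w = 1 + e_1 v] at the constants this is [tau (2 v_j)]: the commutator
    with [t_jn] is [tau v_j], and the one with [d_n] is [tau (2 v_n)]. *)
Definition col_word q w (j : 'I_n) : H :=
  if j == ord_max then [~ q (d ord_max), w] else [~ w, q (t j ord_max)] ^+ 2.

Definition entry_word q x (i j : 'I_n) : H :=
  if j == ord0 then if i == ord0 then unit_word q else 1
  else col_word q (row_word q x i) j.

End Words.

Section Entries.
Variables (m : nat) (F : fieldType).
Hypothesis F2 : 2%N \notin [pchar F].

Local Notation n := m.+2.
Local Notation last := (ord_max : 'I_n).
Local Notation first := (ord0 : 'I_n).
Local Notation G := (proj_triangular n F).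
Implicit Types (i j : 'I_n) (A : 'M[F]_n) (x : G) (v : 'I_n -> F).

(** The matrix [e_1 v]. *)
Definition top_row v : 'M[F]_n := \matrix_(i, j) ((i == first)%:R * v j).

(** Normalised matrices fix [e_1]. *)
Lemma mulmx_top A v : normal A -> A *m top_row v = top_row v.
Proof.
move=> nA; have E (v' : 'I_n -> F) :
    top_row v' = delta_mx first (0 : 'I_1) *m \row_j v' j.
  by apply/matrixP => i j; rewrite !mxE big_ord1 !mxE eqxx andbT.
by rewrite E mulmxA normal_col0.
Qed.

Lemma delta_mulmx_top A i : delta_mx first i *m A = top_row (A i).
Proof. by apply/matrixP => u v; rewrite delta_mulmxE mxE. Qed.

Lemma top_rowD u v : top_row u + top_row v = top_row (fun j => u j + v j).
Proof. by apply/matrixP => i j; rewrite !mxE mulrDr. Qed.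

Lemma normal_top v : v first = 0 -> normal (1%:M + top_row v).
Proof.
move=> v0; split=> [i j ij|i|]; rewrite !mxE.
- rewrite -[i == j]val_eqE gtn_eqF // add0r.
  by have [i0|_] := eqVneq i first; [rewrite i0 in ij | rewrite mul0r].
- rewrite eqxx; have [->|_] := eqVneq i first.
    by rewrite v0 mulr0 addr0 oner_neq0.
  by rewrite mul0r addr0 oner_neq0.
- by rewrite v0 mulr0 addr0.
Qed.

Lemma top_mul_delta v i j : i != first ->
  (1%:M + top_row v) *m delta_mx i j = delta_mx i j + v i *: delta_mx first j.
Proof.
move=> i0; rewrite mulmxDl mul1mx; congr (_ + _); apply/matrixP => a b.
by rewrite mulmx_deltaE !mxE mulrC mulrA -natrM mulnb andbC mulrC.
Qed.

Lemma delta_mul_top v i j : j != first ->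
  delta_mx i j *m (1%:M + top_row v) = delta_mx i j.
Proof.
move=> j0; apply/matrixP => a b; rewrite delta_mulmxE !mxE (negPf j0) mul0r addr0.
by rewrite -natrM mulnb [b == j]eq_sym.
Qed.

Variables (k : nat) (t : 'I_n -> 'I_n -> 'I_k) (d : 'I_n -> 'I_k) (c : 'I_k -> G).
Hypothesis tP : forall i j (ij : (i < j)%N),
  c (t i j) = cquot (t_elt F (exist _ (i, j) ij)).
Hypothesis dP : forall i, c (d i) = cquot (d_elt F i).

Lemma mat_t i j : (i < j)%N -> mat (c (t i j)) = 1%:M + delta_mx i j.
Proof.
move=> ij; have [_ _] := normal_elem (1 : F) ij; rewrite scale1r => n1.
by rewrite tP mat_cquot //= /t_mx /= normalizeK.
Qed.

Lemma mat_d i : i != first -> mat (c (d i)) = 1%:M - 2 *: delta_mx i i.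
Proof.
move=> i0; have [_ _ n1] := normal_sign F i0.
by rewrite dP mat_cquot //= d_mxE normalizeK.
Qed.

Lemma mat_d0 : mat (c (d first)) = 2 *: delta_mx first first - 1%:M.
Proof.
rewrite dP mat_cquot //= d_mxE /normalize !mxE eqxx /= mulr1.
by rewrite opprD addNKr invrN invr1 scaleN1r opprB.
Qed.

Let reduced_row x i j : F := 2 * (mat x i j - ((i == first) && (j == first))%:R).

Lemma mat_row_word x i :
  mat (row_word t d c x i) = 1%:M + top_row (reduced_row x i).
Proof.
have nx := mat_normal x; have [tx _ x0] := nx.
have r0 : reduced_row x i first = 0.
  rewrite /reduced_row; have [->|i0] := eqVneq i first.
    by rewrite x0 subrr mulr0.
  by rewrite tx ?lt0n //= subr0 mulr0.
rewrite -[RHS](eq_eltK F2); last exact: normal_top.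
congr mat; rewrite /row_word; case: eqVneq => [i0|i0].
  apply/commg_eq/(mat_inj F2).
  rewrite !(matM F2) (eq_eltK F2); last exact: normal_top.
  rewrite mat_d0 [mat x *m _]mulmxBr mulmx1 -(scalemxAr _ (mat x)) normal_col0 //.
  rewrite mulmxDr mulmx1 !mulmxBl mul1mx -!(scalemxAl _ (delta_mx _ _)) !delta_mulmx_top.
  rewrite mulmx_top //; apply/matrixP => a b; rewrite !mxE i0 eqxx mul1r.
  have [->|a0] := eqVneq a first; last by rewrite !mul0r !mulr0 subrr addr0.
  by rewrite !mul1r /reduced_row eqxx /=; set w := (b == _)%:R; ring.
rewrite expg2; set e := eq_elt _.
suff -> : (c (t first i) ^ x)%g = eq_elt (1%:M + top_row (mat x i)).
  have t0 : mat x i first = 0 by rewrite tx // lt0n.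
  rewrite -(eq_eltM F2); [congr eq_elt|exact: normal_top|exact: normal_top].
  rewrite mulmxDr mulmx1 mulmx_top; last exact: normal_top.
  rewrite -addrA top_rowD; congr (_ + top_row _); apply/funext => j.
  by rewrite /reduced_row (negPf i0) /= subr0 mulr_natl mulr2n.
rewrite /conjg; apply: (mulgI x); rewrite mulVKg; apply: (mat_inj F2).
have t0 : mat x i first = 0 by rewrite tx // lt0n.
rewrite !(matM F2) (eq_eltK F2); last exact: normal_top.
rewrite mat_t ?lt0n // mulmxDl mul1mx mulmxDr mulmx1 mulmx_top //.
by rewrite delta_mulmx_top.
Qed.

Lemma mat_col_word w v j : j != first -> v first = 0 -> mat w = 1%:M + top_row v ->
  col_word t d c w j = tau m (2 * v j).
Proof.
move=> j0 v0 wE; have nw : normal (mat w) by apply: mat_normal.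
have dw i j' : i != first -> delta_mx j' i *m mat w = delta_mx j' i.
  by move=> i0; rewrite wE delta_mul_top.
have wd i j' : i != first ->
    mat w *m delta_mx i j' = delta_mx i j' + v i *: delta_mx first j'.
  by move=> i0; rewrite wE top_mul_delta.
rewrite /col_word; case: eqVneq => [jl|jl].
  apply/commg_eq/(mat_inj F2); rewrite !(matM F2) (mat_tau _ F2) mat_d // -jl.
  have nD : normal (1%:M - 2 *: delta_mx j j) := normal_sign F j0.
  rewrite mulmxDr mulmx1 -(scalemxAr (2 * v j)) normal_col0; last exact: normalM.
  rewrite mulmxBl mulmxBr mul1mx mulmx1 -scalemxAl dw // -scalemxAr wd //.
  by rewrite scalerDr scalerA jl opprD addrA subrK.
have lt_jl : (j < last)%N by rewrite ltn_neqAle jl -ltnS ltn_ord.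
rewrite (_ : [~ _, _]%g = tau m (v j)); first by rewrite (tauX _ F2) mulr_natl.
apply/commg_eq/(mat_inj F2); rewrite !(matM F2) (mat_tau _ F2) mat_t //.
have nT : normal (1%:M + delta_mx j last : 'M[F]_n).
  by have := normal_elem (1 : F) lt_jl; rewrite scale1r.
rewrite [RHS]mulmxDr mulmx1 -(scalemxAr (v j)) normal_col0; last exact: normalM.
by rewrite mulmxDl mulmxDr mul1mx mulmx1 dw // wd // addrA.
Qed.

Lemma corner_star : corner t c = tau m 1.
Proof. by rewrite -[LHS](matK F2) /corner mat_t // -(scale1r (delta_mx _ _)). Qed.

Lemma unit_word_star : unit_word t c = tau m 4.
Proof. by rewrite /unit_word corner_star (tauX _ F2). Qed.

(** The row word and the column word contribute a factor 2 each. *)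
Lemma entry_word_star x i j :
  entry_word t d c x i j = tau m (4 * mat x i j).
Proof.
have [tx _ x0] := mat_normal x.
rewrite /entry_word; case: eqVneq => [->|j0].
  case: eqVneq => [->|i0]; first by rewrite x0 mulr1 unit_word_star.
  by rewrite tx ?lt0n // mulr0 (tau0 _ F2).
rewrite (mat_col_word j0 _ (mat_row_word x i)); last first.
  rewrite /reduced_row; have [->|i0] := eqVneq i first.
    by rewrite x0 subrr mulr0.
  by rewrite tx ?lt0n //= subr0 mulr0.
by rewrite /reduced_row (negPf j0) andbF subr0 mulrA -natrM.
Qed.

End Entries.

(** * Definability in groups and rings *)

Section GroupDefinability.
Variables (H : groupType) (V : Type).
Local Notation S := (group_structure H).
Local Notation tdef := (@term_definable group_language S V).
Implicit Types (f g : (V -> H) -> H).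
Local Open Scope group_scope.

Lemma tdef_mulg f g : tdef f -> tdef g -> tdef (fun e => f e * g e).
Proof.
move=> df dg; apply: (@tdef_app _ S V GMul (fun i => if i == ord0 then f else g)).
by move=> i; case: ifP.
Qed.

Lemma tdef_invg f : tdef f -> tdef (fun e => (f e)^-1).
Proof. by move=> df; apply: (@tdef_app _ S V GInv (fun=> f)). Qed.

Lemma tdef_one : tdef (fun=> 1).
Proof. by apply: (@tdef_app _ S V GOne (fun i e => 1)) => -[]. Qed.

Lemma tdef_conjg f g : tdef f -> tdef g -> tdef (fun e => f e ^ g e).
Proof. by move=> df dg; do ?apply: tdef_mulg => //; apply: tdef_invg. Qed.

Lemma tdef_commg f g : tdef f -> tdef g -> tdef (fun e => [~ f e, g e]).
Proof. by move=> df dg; apply/tdef_mulg/tdef_conjg => //; apply: tdef_invg. Qed.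

Lemma tdef_expg f i : tdef f -> tdef (fun e => f e ^+ i).
Proof.
move=> df; elim: i => [|i IH]; first exact: tdef_one.
by under eq_fun do rewrite expgS; apply: tdef_mulg.
Qed.

Lemma tdef_prod (I : Type) (r : seq I) (h : I -> (V -> H) -> H) :
  (forall i, tdef (h i)) -> tdef (fun e => \prod_(i <- r) h i e).
Proof.
move=> dh; elim: r => [|i r IH].
  by under eq_fun do rewrite big_nil; apply: tdef_one.
by under eq_fun do rewrite big_cons; apply: tdef_mulg.
Qed.

End GroupDefinability.

Ltac group_term := repeat first
  [ apply: tdef_var | apply: tdef_one | apply: tdef_mulg | apply: tdef_invg
  | apply: tdef_expg | apply: tdef_commg | apply: tdef_conjg ].

Lemma def_central_commutator (H : groupType) V (f : (V -> H) -> H) :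
  term_definable (A := group_structure H) f ->
  definable (A := group_structure H) (fun e => central_commutator (f e)).
Proof.
move=> df; have [|a aP] := @def_subst _ (group_structure H) unit V
  (fun e => central_commutator (e tt)) (fun=> f) _ (fun=> df); last by exists a.
by apply: def_and; do 2!(apply: def_ex || apply: def_all); apply: def_eq; group_term.
Qed.

(** Multiplication read off from conjugation, with [u] as unit: a conjugation
    that takes [u] to [x] takes [y] to the product.  The zero of the field, which
    is the neutral element of the group, is no conjugate of [u]. *)
Definition scaled_mul (H : groupType) (u x y z : H) : Prop :=
  (x = 1%g /\ z = 1%g) \/ exists g, (g * u = x * g /\ g * y = z * g)%g.

Lemma def_scaled_mul (H : groupType) V (f1 f2 f3 f4 : (V -> H) -> H) :
  term_definable (A := group_structure H) f1 ->
  term_definable (A := group_structure H) f2 ->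
  term_definable (A := group_structure H) f3 ->
  term_definable (A := group_structure H) f4 ->
  definable (A := group_structure H)
    (fun e => scaled_mul (f1 e) (f2 e) (f3 e) (f4 e)).
Proof.
move=> d1 d2 d3 d4; apply: def_or.
  by apply: def_and; apply: def_eq => //; group_term.
by apply: def_ex; apply: def_and; apply: def_eq; group_term; apply: tdef_rename.
Qed.

Section RingDefinability.
Variables (R : pzRingType) (V : Type).
Local Notation S := (ring_structure R).
Local Notation tdef := (@term_definable ring_language S V).
Local Notation def := (@definable ring_language S V).
Implicit Types (f g : (V -> R) -> R).

Lemma tdef_addr f g : tdef f -> tdef g -> tdef (fun e => f e + g e).
Proof.
move=> df dg; apply: (@tdef_app _ S V RAdd (fun i => if i == ord0 then f else g)).
by move=> i; case: ifP.
Qed.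

Lemma tdef_mulr f g : tdef f -> tdef g -> tdef (fun e => f e * g e).
Proof.
move=> df dg; apply: (@tdef_app _ S V RMul (fun i => if i == ord0 then f else g)).
by move=> i; case: ifP.
Qed.

Lemma tdef_0 : tdef (fun=> 0).
Proof. by apply: (@tdef_app _ S V RZero (fun i e => 0)) => -[]. Qed.

Lemma tdef_1 : tdef (fun=> 1).
Proof. by apply: (@tdef_app _ S V ROne (fun i e => 0)) => -[]. Qed.

Lemma tdef_nat i : tdef (fun=> i%:R).
Proof.
elim: i => [|i IH]; first exact: tdef_0.
by under eq_fun do rewrite mulrS; apply: tdef_addr => //; apply: tdef_1.
Qed.

Lemma tdef_sum (I : Type) (r : seq I) (h : I -> (V -> R) -> R) :
  (forall i, tdef (h i)) -> tdef (fun e => \sum_(i <- r) h i e).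
Proof.
move=> dh; elim: r => [|i r IH].
  by under eq_fun do rewrite big_nil; apply: tdef_0.
by under eq_fun do rewrite big_cons; apply: tdef_addr.
Qed.

Lemma def_eq_mx n (M N : (V -> R) -> 'M[R]_n) :
  (forall i j, tdef (fun e => M e i j)) ->
  (forall i j, tdef (fun e => N e i j)) ->
  def (fun e => M e = N e).
Proof.
move=> dM dN.
have [|a aP] := @def_forall_fin _ S V ('I_n * 'I_n)%type
  (fun ij e => M e ij.1 ij.2 = N e ij.1 ij.2).
  by move=> ij; apply: def_eq.
exists a => e; rewrite aP; split=> [E|-> //].
by apply/matrixP => i j; apply: (E (i, j)).
Qed.

Lemma tdef_mulmx n (M N : (V -> R) -> 'M[R]_n) :
  (forall i j, tdef (fun e => M e i j)) ->
  (forall i j, tdef (fun e => N e i j)) ->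
  forall i j, tdef (fun e => (M e *m N e) i j).
Proof.
move=> dM dN i j; under eq_fun do rewrite mxE.
by apply: tdef_sum => s; apply: tdef_mulr.
Qed.

Lemma tdef_scalar_mx n (i j : 'I_n) : tdef (fun=> (1%:M : 'M[R]_n) i j).
Proof. by under eq_fun do rewrite mxE; apply: tdef_nat. Qed.

End RingDefinability.

(** * The group coded in the field, and the field in the group *)

Section MatrixCode.
Variables (m : nat) (F : fieldType).
Hypothesis F2 : 2%N \notin [pchar F].

Local Notation n := m.+2.
Local Notation first := (ord0 : 'I_n).
Local Notation G := (proj_triangular n F).
Local Notation FS := (ring_structure F).
Local Notation GS := (group_structure G).

Definition tuple_mx (x : 'I_(n * n) -> F) : 'M[F]_n :=
  \matrix_(i, j) x (mxvec_index i j).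

Definition mx_tuple (A : 'M[F]_n) (s : 'I_(n * n)) : F := mxvec A ord0 s.

Lemma mx_tupleK : cancel mx_tuple tuple_mx.
Proof. by move=> A; apply/matrixP => i j; rewrite mxE /mx_tuple mxvecE. Qed.

Lemma tuple_mxK : cancel tuple_mx mx_tuple.
Proof.
move=> x; apply/funext => s; case/mxvec_indexP: s => i j.
by rewrite /mx_tuple mxvecE mxE.
Qed.

Lemma tdef_tuple_mx V (r : 'I_(n * n) -> V) i j :
  term_definable (A := FS) (fun e : V -> F => tuple_mx (fun s => e (r s)) i j).
Proof. by under eq_fun do rewrite mxE; apply: tdef_var. Qed.

Lemma def_normal :
  definable (A := FS) (fun e : 'I_(n * n) + 'I_0 -> F =>
    normal (tuple_mx (fun s => e (inl s)))).
Proof.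
have [||a aP] := @def_and _ FS ('I_(n * n) + 'I_0)%type
  (fun e => forall ij : 'I_n * 'I_n, (ij.2 < ij.1)%N ->
    tuple_mx (fun s => e (inl s)) ij.1 ij.2 = 0)
  (fun e => (forall i, ~ (tuple_mx (fun s => e (inl s)) i i = 0)) /\
    tuple_mx (fun s => e (inl s)) first first = 1).
- apply: def_forall_fin => ij; apply: def_guard => _.
  by apply: def_eq; [apply: tdef_tuple_mx | apply: tdef_0].
- apply: def_and; first apply: def_forall_fin => i; first apply: def_not;
    apply: def_eq; by [apply: tdef_tuple_mx | apply: tdef_0 | apply: tdef_1].
exists a => e; rewrite aP; split=> [[tA [dA A1]]|[tA dA A1]].
  by split=> // [i j ij|i]; [apply: (tA (i, j)) | apply/eqP].
by split=> [[i j]|]; [apply: tA | split=> // i; apply/eqP].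
Qed.

Definition matrix_op (f : group_symbol)
    (A : 'I_(@arity group_language f) -> 'M[F]_n) (B : 'M[F]_n) : Prop :=
  match f return ('I_(@arity group_language f) -> 'M[F]_n) -> Prop with
  | GMul => fun A => B = A ord0 *m A ord_max
  | GInv => fun A => A ord0 *m B = 1%:M
  | GOne => fun=> B = 1%:M
  end A.

Lemma def_matrix_op f :
  definable (A := FS)
    (fun e : 'I_(@arity group_language f) * 'I_(n * n) + 'I_(n * n) + 'I_0 -> F =>
      matrix_op (fun i => tuple_mx (fun s => e (inl (inl (i, s)))))
                (tuple_mx (fun s => e (inl (inr s))))).
Proof.
by case: f => /=; apply: def_eq_mx => i j; do ?apply: tdef_mulmx => *;
  by [apply: tdef_scalar_mx | apply: tdef_tuple_mx].
Qed.

Lemma def_tuple_eq :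
  definable (A := FS) (fun e : 'I_(n * n) + 'I_(n * n) + 'I_0 -> F =>
    forall s, e (inl (inl s)) = e (inl (inr s))).
Proof. by apply: def_forall_fin => s; apply: def_eq; apply: tdef_var. Qed.

Definition matrix_code : code group_language ring_language 0 :=
  @Code group_language ring_language 0 (n * n)
    (formula_of def_normal) (formula_of def_tuple_eq)
    (fun f => formula_of (def_matrix_op f)).

Lemma matrix_code_dom p x :
  code_dom (Gamma := matrix_code) (B := FS) p x <-> normal (tuple_mx x).
Proof. exact: formula_ofP. Qed.

Definition decode_matrix (x : 'I_(n * n) -> F) : G := eq_elt (tuple_mx x).

Lemma matrix_code_decoding (p : 'I_0 -> F) :
  @decoding _ _ _ matrix_code FS p GS decode_matrix.
Proof.
have eltE x a : normal (tuple_mx x) -> eq_elt (tuple_mx x) = a <-> tuple_mx x = mat a.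
  by move=> nx; split=> [<-|->]; [rewrite eq_eltK | rewrite matK].
split.
- move=> a; exists (mx_tuple (mat a)).
    by apply/matrix_code_dom; rewrite mx_tupleK; apply: mat_normal.
  by rewrite /decode_matrix mx_tupleK matK.
- move=> x y /matrix_code_dom nx /matrix_code_dom ny.
  rewrite /code_eq formula_ofP /decode_matrix /= eltE // eq_eltK //.
  split=> [xy|/(can_inj tuple_mxK) -> //].
  by congr tuple_mx; apply/funext.
- move=> f x y dx /matrix_code_dom ny.
  have nx i : normal (tuple_mx (x i)) by apply/matrix_code_dom.
  rewrite /code_sym formula_ofP /decode_matrix /= eltE //.
  case: f x dx nx => x dx nx /=.
  + by rewrite (matM F2) !eq_eltK.
  + have [_ uA] := upper_unitP _ (normal_unit (nx ord0)).
    have E : tuple_mx (x ord0) *m mat (eq_elt (tuple_mx (x ord0)))^-1%g = 1%:M.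
      by rewrite -[X in X *m _](eq_eltK F2) // -(matM F2) mulgV (mat1 _ F2).
    split=> [E'|->]; last exact: E.
    by apply: (can_inj (mulKmx uA)); rewrite E.
  + by rewrite (mat1 _ F2).
Qed.

End MatrixCode.

Section CentreCode.
Variables (m : nat) (F : fieldType).
Hypothesis F2 : 2%N \notin [pchar F].

Local Notation n := m.+2.
Local Notation first := (ord0 : 'I_n).
Local Notation last := (ord_max : 'I_n).
Local Notation G := (proj_triangular n F).
Local Notation FS := (ring_structure F).
Local Notation GS := (group_structure G).
Local Notation tau := (@tau m F).

Lemma tau_inj : injective tau.
Proof. exact: can_inj (tauK m F2). Qed.

Lemma tau_eq1 s : tau s = 1%g <-> s = 0.
Proof. by rewrite -(tau0 m F2); split=> [/tau_inj|->]. Qed.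

(** Conjugation by [g] divides the argument of [tau] by [g_nn]; the matrix
    [D = diag(1, ..., 1, 1/s)] realises multiplication by [s]. *)
Lemma scaled_mul_tau u s s' z : u != 0 ->
  scaled_mul (tau u) (tau (u * s)) (tau (u * s')) z <-> z = tau (u * (s * s')).
Proof.
move=> u0; split.
  case=> [[/tau_eq1/eqP]|[g []]].
    by rewrite mulf_eq0 (negPf u0) /= => /eqP-> ->; rewrite mul0r mulr0 (tau0 _ F2).
  move=> /(tau_conj F2); rewrite -[X in X = _]mulr1 -mulrA => /(mulfI u0) sg zg.
  apply: (mulIg g); rewrite -zg; apply/(tau_conj F2).
  by rewrite -mulrA -[s * s']mulrC -mulrA -sg mulr1.
move=> ->; have [->|s0] := eqVneq s 0; first by left; rewrite mul0r mulr0 (tau0 _ F2).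
(* For [s = 0] no conjugation exists; otherwise the last diagonal entry of [D]
   is the inverse of [s]. *)
right; pose D : 'M[F]_n := 1%:M + (s^-1 - 1) *: delta_mx last last.
have nD : normal D.
  split=> [i j ij|i|]; rewrite !mxE.
  - have ij0 : i == j = false by rewrite -val_eqE gtn_eqF.
    have -> : (i == last) && (j == last) = false.
      by apply/negP => /andP[/eqP il /eqP jl]; rewrite il jl eqxx in ij0.
    by rewrite ij0 mulr0 addr0.
  - rewrite eqxx andbb; case: (i == last); last by rewrite mulr0 addr0 oner_neq0.
    by rewrite mulr1 addrC subrK invr_neq0.
  - by rewrite eqxx andbb mulr0 addr0.
have Dl : mat (eq_elt D) last last = s^-1.
  by rewrite (eq_eltK F2) // !mxE !eqxx mulr1 addrC subrK.
exists (eq_elt D); split; apply/(tau_conj F2); rewrite Dl.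
  by rewrite mulfK.
by rewrite [s * s']mulrC mulrA mulfK.
Qed.

Variables (k : nat) (t : 'I_n -> 'I_n -> 'I_k) (d : 'I_n -> 'I_k).

Lemma tdef_unit_word V (q : 'I_k -> (V -> G) -> G) :
  (forall i, term_definable (A := GS) (q i)) ->
  term_definable (A := GS) (fun e => unit_word t (fun i => q i e)).
Proof. by move=> dq; apply: tdef_expg; apply: (dq (t first last)). Qed.

Lemma tdef_entry_word V (q : 'I_k -> (V -> G) -> G) (x : (V -> G) -> G) i j :
  (forall i, term_definable (A := GS) (q i)) -> term_definable (A := GS) x ->
  term_definable (A := GS) (fun e => entry_word t d (fun i => q i e) (x e) i j).
Proof.
move=> dq dx; rewrite /entry_word; case: (j == first).
  by case: (i == first); [exact: (tdef_unit_word dq) | exact: tdef_one].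
have dr : term_definable (A := GS) (fun e => row_word t d (fun i => q i e) (x e) i).
  rewrite /row_word; case: (i == first); first by apply: tdef_commg => //.
  by apply: tdef_expg; apply: tdef_conjg.
rewrite /col_word; case: (j == last); first by apply: tdef_commg => //.
by apply: tdef_expg; apply: tdef_commg.
Qed.

Definition field_op (f : ring_symbol) (u : G)
    (x : 'I_(@arity ring_language f) -> G) (y : G) : Prop :=
  match f return ('I_(@arity ring_language f) -> G) -> Prop with
  | RAdd => fun x => y = (x ord0 * x ord_max)%g
  | ROpp => fun x => y = ((x ord0)^-1)%g
  | RZero => fun=> y = 1%g
  | RMul => fun x => scaled_mul u (x ord0) (x ord_max) y
  | ROne => fun=> y = u
  end x.

Lemma def_field_op f :
  definable (A := GS)
    (fun e : 'I_(@arity ring_language f) * 'I_1 + 'I_1 + 'I_k -> G =>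
      field_op (unit_word t (fun i => e (inr i)))
        (fun i => e (inl (inl (i, ord0)))) (e (inl (inr ord0)))).
Proof.
have du := @tdef_unit_word _
  (fun i (e : 'I_(@arity ring_language f) * 'I_1 + 'I_1 + 'I_k -> G) => e (inr i))
  (fun i => tdef_var _ _).
by case: f du => /= du; [apply: def_eq; group_term..|apply: def_scaled_mul; group_term|
  apply: def_eq; group_term].
Qed.

Lemma def_centre : definable (A := GS)
  (fun e : 'I_1 + 'I_k -> G => central_commutator (e (inl ord0))).
Proof. by apply: def_central_commutator; apply: tdef_var. Qed.

Lemma def_centre_eq : definable (A := GS)
  (fun e : 'I_1 + 'I_1 + 'I_k -> G => e (inl (inl ord0)) = e (inl (inr ord0))).
Proof. by apply: def_eq; apply: tdef_var. Qed.

Definition centre_code : code ring_language group_language k :=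
  @Code ring_language group_language k 1
    (formula_of def_centre) (formula_of def_centre_eq)
    (fun f => formula_of (def_field_op f)).

Lemma centre_code_dom q x : code_dom (Gamma := centre_code) (B := GS) q x <->
  exists s, x ord0 = tau s.
Proof. by rewrite -(central_commutatorP F2); apply: formula_ofP. Qed.

Definition decode_centre (u : F) (x : 'I_1 -> G) : F := coef (x ord0) / u.

(** The code sees of [q] only the unit, and any [tau u <> 1] can serve as unit:
    the field it yields is the original one scaled by [u]. *)
Lemma centre_code_decoding (q : 'I_k -> G) u :
  u != 0 -> unit_word t q = tau u ->
  @decoding _ _ _ centre_code GS q FS (decode_centre u).
Proof.
move=> u0 uE.
have domE x : code_dom (Gamma := centre_code) (B := GS) q x ->
    x ord0 = tau (u * decode_centre u x).
  by move=> /centre_code_dom[s sE]; rewrite /decode_centre sE (tauK _ F2) mulrC divfK.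
have codeE s : decode_centre u (fun=> tau (u * s)) = s.
  by rewrite /decode_centre (tauK _ F2) mulrC mulKf.
split.
- move=> s; exists (fun=> tau (u * s)) => //.
  by apply/centre_code_dom; exists (u * s).
- move=> x y /domE xE /domE yE; rewrite /code_eq formula_ofP /= xE yE.
  by split=> [/tau_inj/(mulfI u0)|->].
- move=> f x y dx /domE yE; have xE i := domE _ (dx i).
  rewrite /code_sym formula_ofP /= yE.
  have tauE s : tau (u * decode_centre u y) = tau (u * s) <-> decode_centre u y = s.
    by split=> [/tau_inj/(mulfI u0)|->].
  case: f x {dx} xE => x xE /=.
  + by rewrite !xE -(tauD _ F2) -mulrDr tauE.
  + by rewrite !xE -(tauN _ F2) -mulrN tauE.
  + by rewrite -(tau0 m F2) -[in X in X <-> _](mulr0 u) tauE.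
  + by rewrite !xE uE scaled_mul_tau // tauE.
  + by rewrite uE -[X in _ = tau X <-> _]mulr1 tauE.
Qed.

End CentreCode.

(** * Coordinate systems *)

Section Coordinates.
Variables (m : nat) (k : nat).
Local Notation n := m.+2.
Variables (t : 'I_n -> 'I_n -> 'I_k) (d : 'I_n -> 'I_k).
Local Notation first := (ord0 : 'I_n).

(** Normality over the coded field, whose 0 is the neutral element of the group
    and whose 1 is the unit word. *)
Definition centre_matrix (H : groupType) (q : 'I_k -> H) (z : 'I_n -> 'I_n -> H) : Prop :=
  [/\ forall i j, central_commutator (z i j),
      forall i j : 'I_n, (j < i)%N -> z i j = 1%g,
      forall i, z i i <> 1%g & z first first = unit_word t q].

(** The admissible tuples of parameters: the entry words map the group
    bijectively and multiplicatively onto the normalised matrices over the coded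
    field.  The last clause is the product of two matrices, whose sums are
    products in the group.  The constants are one such tuple.  Asking for this
    property, rather than for an image of the constants under an automorphism,
    makes the definable isomorphism part of the condition. *)
Definition coordinates (H : groupType) (q : 'I_k -> H) : Prop :=
  let entry := entry_word t d q in
  [/\ central_commutator (corner t q) /\ corner t q <> 1%g,
      forall x, centre_matrix q (entry x),
      forall z : 'I_(n * n) -> H, centre_matrix q (fun i j => z (mxvec_index i j)) ->
        exists x, forall i j, entry x i j = z (mxvec_index i j),
      forall x y, (forall i j, entry x i j = entry y i j) -> x = y
    & forall x y i j, exists p : 'I_n -> H,
        (forall s, scaled_mul (unit_word t q) (entry x i s) (entry y s j) (p s))
        /\ entry (x * y)%g i j = (\prod_s p s)%g].

Section Definability.
Variables (F : fieldType).
Local Notation G := (proj_triangular n F).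
Local Notation GS := (group_structure G).

Lemma def_centre_matrix V (q : 'I_k -> (V -> G) -> G)
    (z : 'I_n -> 'I_n -> (V -> G) -> G) :
  (forall i, term_definable (A := GS) (q i)) ->
  (forall i j, term_definable (A := GS) (z i j)) ->
  definable (A := GS) (fun e => centre_matrix (fun i => q i e) (fun i j => z i j e)).
Proof.
move=> dq dz.
have [||a aP] := @def_and _ GS V
  (fun e => forall i j, central_commutator (z i j e))
  (fun e => (forall i j : 'I_n, (j < i)%N -> z i j e = 1%g) /\
    (forall i, ~ (z i i e = 1%g)) /\ z first first e = unit_word t (fun i => q i e)).
- by do 2!(apply: def_forall_fin => ?); apply: def_central_commutator.
- apply: def_and.
    do 2!(apply: def_forall_fin => ?); apply: def_guard => _.
    by apply: def_eq => //; apply: tdef_one.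
  apply: def_and; last by apply: def_eq => //; apply: tdef_unit_word.
  by apply: def_forall_fin => ?; apply: def_not; apply: def_eq => //; apply: tdef_one.
by exists a => e; rewrite aP; split=> [[? [? []]]|[]].
Qed.

Lemma def_coordinates : definable (A := GS) (fun q : 'I_k -> G => coordinates q).
Proof.
have [||a aP] := @def_and _ GS 'I_k
  (fun q => (central_commutator (corner t q) /\ ~ (corner t q = 1%g)) /\
    forall x, centre_matrix q (entry_word t d q x))
  (fun q => (forall z : 'I_(n * n) -> G,
      centre_matrix q (fun i j => z (mxvec_index i j)) ->
      exists x, forall i j, entry_word t d q x i j = z (mxvec_index i j)) /\
    (forall x y, (forall i j, entry_word t d q x i j = entry_word t d q y i j) -> x = y)
    /\ forall x y i j, exists p : 'I_n -> G,
        (forall s, scaled_mul (unit_word t q) (entry_word t d q x i s)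
                     (entry_word t d q y s j) (p s))
        /\ entry_word t d q (x * y)%g i j = (\prod_s p s)%g).
- apply: def_and.
    apply: def_and; first by apply: def_central_commutator; apply: tdef_var.
    by apply: def_not; apply: def_eq; [apply: tdef_var | apply: tdef_one].
  apply: def_all; apply: def_centre_matrix => *; first exact: tdef_var.
  by apply: tdef_entry_word => *; apply: tdef_var.
- apply: def_and.
    apply: def_all_tuple; apply: def_imp.
      by apply: def_centre_matrix => *; apply: tdef_var.
    apply: def_ex; do 2!(apply: def_forall_fin => ?).
    apply: def_eq; last exact: tdef_var.
    by apply: tdef_entry_word => *; apply: tdef_var.
  apply: def_and.
    do 2!apply: def_all; apply: def_imp; last by apply: def_eq; apply: tdef_var.
    do 2!(apply: def_forall_fin => ?).
    by apply: def_eq; apply: tdef_entry_word => *; apply: tdef_var.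
  do 2!apply: def_all.
  do 2!(apply: def_forall_fin => ?); apply: def_ex_tuple; apply: def_and.
    apply: def_forall_fin => ?; apply: def_scaled_mul; last exact: tdef_var.
    + by apply: tdef_unit_word => *; apply: tdef_var.
    + by apply: tdef_entry_word => *; apply: tdef_var.
    + by apply: tdef_entry_word => *; apply: tdef_var.
  apply: def_eq; last by apply: tdef_prod => *; apply: tdef_var.
  by apply: tdef_entry_word => *; [apply: tdef_var | apply: tdef_mulg; apply: tdef_var].
by exists a => e; rewrite aP; split=> [[[? ?] [? []]]|[]].
Qed.

End Definability.
End Coordinates.

(** * The bi-interpretation *)

Section BiInterpretation.
Variables (m : nat) (F : fieldType).
Hypothesis F2 : 2%N \notin [pchar F].

Local Notation n := m.+2.
Local Notation first := (ord0 : 'I_n).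
Local Notation last := (ord_max : 'I_n).
Local Notation G := (proj_triangular n F).
Local Notation FS := (ring_structure F).
Local Notation GS := (group_structure G).
Local Notation tau := (@tau m F).

Variables (k : nat) (t : 'I_n -> 'I_n -> 'I_k) (d : 'I_n -> 'I_k).
Implicit Types (q : 'I_k -> G) (x y : G).
Local Notation entry := (entry_word t d).

Let four_neq0 : 4 != 0 :> F.
Proof. by rewrite (natrM _ 2 2) mulf_neq0 //; move: F2; rewrite inE. Qed.

(** Matrices over the coded field are matrices over [F], scaled by the unit. *)
Lemma centre_matrixP q u (z : 'I_n -> 'I_n -> G) :
  u != 0 -> unit_word t q = tau u ->
  centre_matrix t q z <->
  exists2 A, normal A & forall i j, z i j = tau (u * A i j).
Proof.
move=> u0 uE; split=> [[zc zt z1 z0]|[A [tA dA A1] zE]].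
  have zE i j : z i j = tau (u * (coef (z i j) / u)).
    have /(central_commutatorP F2)[s ->] := zc i j.
    by rewrite (tauK _ F2) mulrC divfK.
  exists (\matrix_(i, j) (coef (z i j) / u)); last by move=> i j; rewrite mxE.
  split=> [i j ij|i|]; rewrite mxE.
  - by rewrite zt // -(tau0 m F2) (tauK _ F2) mul0r.
  - apply/negP => /eqP E; apply: (z1 i).
    by rewrite zE E mulr0 (tau0 _ F2).
  - by rewrite z0 uE (tauK _ F2) divff.
split=> [i j|i j ij|i|].
- by apply/(central_commutatorP F2); exists (u * A i j).
- by rewrite zE tA // mulr0 (tau0 _ F2).
- by rewrite zE (tau_eq1 _ F2) => /eqP; rewrite mulf_eq0 (negPf u0) (negPf (dA i)).
- by rewrite zE A1 mulr1 uE.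
Qed.

Lemma coordinates_star (c : 'I_k -> G) :
  (forall (i j : 'I_n) (ij : (i < j)%N),
    c (t i j) = cquot (t_elt F (exist _ (i, j) ij))) ->
  (forall i, c (d i) = cquot (d_elt F i)) ->
  coordinates t d c.
Proof.
move=> tP dP.
have entryE := entry_word_star F2 tP dP.
have uE := unit_word_star F2 tP.
have tau4_inj : injective (fun s => tau (4 * s)).
  by move=> s s' /(tau_inj F2)/(mulfI four_neq0).
split.
- rewrite (corner_star F2 tP); split; first by apply/(central_commutatorP F2); exists 1.
  by rewrite (tau_eq1 _ F2); apply/eqP/oner_neq0.
- move=> x; apply/(centre_matrixP _ four_neq0 uE).
  by exists (mat x); [exact: mat_normal | exact: entryE].
- move=> z /(centre_matrixP _ four_neq0 uE)[A nA zE].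
  by exists (eq_elt A) => i j; rewrite entryE (eq_eltK F2) // zE.
- move=> x y E; apply: (mat_inj F2); apply/matrixP => i j.
  by apply: tau4_inj; rewrite -!entryE.
- move=> x y i j; exists (fun s => tau (4 * (mat x i s * mat y s j))).
  split=> [s|]; first by rewrite !entryE uE; apply/(scaled_mul_tau F2 _ _ _ four_neq0).
  by rewrite entryE (matM F2) mxE mulr_sumr (tau_prod _ F2).
Qed.

(** Reading the matrix of entry words back as an element of the group is an
    automorphism [h]: up to [h] and to the scaling by [u], every admissible tuple
    behaves as the constants do. *)
Lemma coordinates_isomorphism q : coordinates t d q ->
  let u := coef (corner t q) *+ 4 in
  [/\ u != 0, unit_word t q = tau u & exists2 h : G -> G,
    isomorphism (A := GS) (B := GS) h
    & forall x i j, entry q x i j = tau (u * mat (h x) i j)].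
Proof.
move=> [[/(central_commutatorP F2)[b bE] b1] ent onto inj mult] u.
have uE : unit_word t q = tau u.
  by rewrite /unit_word /u bE (tauX _ F2) (tauK _ F2).
have u0 : u != 0.
  rewrite /u bE (tauK _ F2) -mulr_natr mulf_neq0 //.
  by apply/negP => /eqP E; apply: b1; rewrite bE E (tau0 _ F2).
have tauu_inj : injective (fun s => tau (u * s)).
  by move=> s s' /(tau_inj F2)/(mulfI u0).
split=> //.
have /choice[M MP] x : exists A, normal A /\ forall i j, entry q x i j = tau (u * A i j).
  by have /(centre_matrixP _ u0 uE)[A] := ent x; exists A.
have nM x : normal (M x) by case: (MP x).
have ME x i j : entry q x i j = tau (u * M x i j) by case: (MP x).
pose h x := eq_elt (M x); have mat_h x : mat (h x) = M x by rewrite eq_eltK.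
exists h; last by move=> x i j; rewrite mat_h.
apply: group_isomorphism.
  have /choice[h' h'P] y : exists x, h x = y.
    have [|x xE] := onto (fun s => tau (u * mx_tuple (mat y) s)).
      apply/(centre_matrixP _ u0 uE); exists (mat y); first exact: mat_normal.
      by move=> i j; rewrite /mx_tuple mxvecE.
    exists x; apply: (mat_inj F2); rewrite mat_h; apply/matrixP => i j.
    by apply: tauu_inj; rewrite -ME xE /mx_tuple mxvecE.
  exists h' => // x; apply: inj => i j; rewrite !ME; congr (tau (u * _)).
  by rewrite -!mat_h h'P.
move=> x y; apply: (mat_inj F2); rewrite (matM F2) !mat_h.
apply/matrixP => i j; have [p [pE]] := mult x y i j.
rewrite ME => E; apply: tauu_inj; rewrite [LHS]E mxE mulr_sumr -(tau_prod _ F2).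
apply: eq_bigr => s _; apply/(scaled_mul_tau F2 _ _ _ u0).
by rewrite -uE -!ME.
Qed.

Definition trivial_formula : formula ring_language 'I_0 :=
  Defs.Implies (Falsum _ _) (Falsum _ _).

Definition coordinates_formula := formula_of (def_coordinates t d F).

Lemma matrix_regular :
  regular_interpretation GS FS (matrix_code m F) trivial_formula.
Proof.
split=> [|p _]; first by exists (fun=> 0).
have dp := matrix_code_decoding m F2 p.
exists (decoding_well_defined dp).
by have [h [ih _]] := decoding_isomorphism dp (decoding_well_defined dp); exists h.
Qed.

Lemma centre_regular (c : 'I_k -> G) : coordinates t d c ->
  regular_interpretation FS GS (centre_code F t) coordinates_formula.
Proof.
move=> cc; split=> [|q]; first by exists c; apply/formula_ofP.
move=> /formula_ofP/coordinates_isomorphism[u0 uE _].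
have dq := centre_code_decoding F2 u0 uE.
exists (decoding_well_defined dq).
by have [h [ih _]] := decoding_isomorphism dq (decoding_well_defined dq); exists h.
Qed.

Lemma def_entry_graph : definable (A := GS)
  (fun e : unit + 'I_(n * n) * 'I_1 + 'I_0 * 'I_1 + 'I_k -> G => forall i j,
     e (inl (inl (inr (mxvec_index i j, ord0)))) =
     entry (fun s => e (inr s)) (e (inl (inl (inl tt)))) i j).
Proof.
do 2!(apply: def_forall_fin => ?); apply: def_eq; first exact: tdef_var.
by apply: tdef_entry_word => *; apply: tdef_var.
Qed.

(** The definable isomorphism sends [x] to the matrix of its entry words.  By
    [coordinates_isomorphism] that is the matrix of [h x] over the coded field, so
    the matching decoding of [matrix_code] is the standard one followed by the
    inverse of [h]. *)
Lemma group_definable_iso :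
  definable_iso GS (matrix_code m F) trivial_formula
    (centre_code F t) coordinates_formula.
Proof.
exists (formula_of def_entry_graph).
move=> q /formula_ofP/coordinates_isomorphism[u0 uE [h ih hE]] wdD p pc _ _.
have [hD [iD hDP]] := decoding_isomorphism (centre_code_decoding F2 u0 uE) wdD.
have [hD' iD' [hDK hD'K]] := isomorphism_inv iD.
have [h' ih' [hK h'K]] := isomorphism_inv ih.
(* [hD] identifies the field with its coded copy, [h'] undoes the automorphism. *)
have dg := decoding_comp (matrix_code_decoding _ F2 (hD' \o pc)) ih'.
have {}dg := decoding_transfer dg iD hDK hD'K.
rewrite (_ : hD \o (hD' \o pc) = pc) in dg; last by apply/funext => -[].
exists (decoding_well_defined dg).
have [h0 [ih0 h0P]] := decoding_isomorphism dg (decoding_well_defined dg).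
exists h0; split=> // x z; rewrite formula_ofP /=.
set u := coef (corner t q) *+ 4 in u0 uE hE hDP *.
have domE zc : code_dom (Gamma := matrix_code m F) pc zc <->
    normal (tuple_mx (hD' \o zc)).
  by rewrite -(code_dom_isomorphism _ _ iD'); apply: matrix_code_dom.
split=> [zE|[zc zzc /h0P[/domE nz /= <-]] i j].
  exists (hD \o mx_tuple (mat (h x))).
    move=> s; case/mxvec_indexP: s => i j; apply/hDP.
    have zij : z (mxvec_index i j) ord0 = tau (u * mat (h x) i j) by rewrite zE hE.
    split; first by apply/(centre_code_dom F2); exists (u * mat (h x) i j).
    by rewrite /decode_centre zij (tauK _ F2) mulrC mulKf // /mx_tuple mxvecE.
  have E : hD' \o (hD \o mx_tuple (mat (h x))) = mx_tuple (mat (h x)).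
    by apply/funext => s /=; rewrite hDK.
  apply/h0P; rewrite domE /= E mx_tupleK; split; first exact: mat_normal.
  by rewrite /decode_matrix mx_tupleK matK.
have := zzc (mxvec_index i j); rewrite -[zc _]hD'K.
move=> /hDP[/(centre_code_dom F2)[s zE]].
rewrite /decode_centre zE (tauK _ F2) => sE.
by rewrite hE h'K (eq_eltK F2) // mxE /= -sE mulrC divfK.
Qed.

(** The matrix of [tau (u s)], where [u] is four times the corner entry of the
    parameter that stands for [t_1n]. *)
Lemma def_root_graph : definable (A := FS)
  (fun e : unit + 'I_1 * 'I_(n * n) + 'I_k * 'I_(n * n) + 'I_0 -> F =>
     tuple_mx (fun s => e (inl (inl (inr (ord0, s))))) =
     1%:M + (e (inl (inr (t first last, mxvec_index first last))) * 4%:R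
              * e (inl (inl (inl tt)))) *: delta_mx first last).
Proof.
apply: def_eq_mx => i j; first exact: tdef_tuple_mx.
under eq_fun do rewrite 4!mxE.
apply: tdef_addr; first exact: tdef_nat.
do 3?apply: tdef_mulr; by [apply: tdef_var | apply: tdef_nat].
Qed.

(** The parameters code a tuple of elements of [G], which satisfies [coordinates];
    thus [tau (u s)] represents [s] in the field coded with this tuple. *)
Lemma field_definable_iso :
  definable_iso FS (centre_code F t) coordinates_formula
    (matrix_code m F) trivial_formula.
Proof.
exists (formula_of def_root_graph) => q _ wdD p pc ppc.
have [hD [iD hDP]] := decoding_isomorphism (matrix_code_decoding m F2 q) wdD.
have [hD' iD' [hDK hD'K]] := isomorphism_inv iD.
have -> : pc = hD \o (hD' \o pc) by apply/funext => i /=; rewrite hD'K.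
rewrite holds_isomorphism // => /formula_ofP/coordinates_isomorphism[].
set u := _ *+ 4 => u0 uE _.
have dg := decoding_transfer (centre_code_decoding F2 u0 uE) iD hDK hD'K.
exists (decoding_well_defined dg).
have [h0 [ih0 h0P]] := decoding_isomorphism dg (decoding_well_defined dg).
exists h0; split=> // x z; rewrite formula_ofP /=.
have uP : p (t first last) (mxvec_index first last) * 4 = u.
  have := ppc (t first last); rewrite -[pc _]hD'K => /hDP[/matrix_code_dom np].
  rewrite /u /coef /corner /= => <-.
  by rewrite /decode_matrix (eq_eltK F2) // mxE mulr_natr.
have domE zc : code_dom (Gamma := centre_code F t) (hD \o (hD' \o pc)) zc <->
    exists s, hD' (zc ord0) = tau s.
  rewrite -(code_dom_isomorphism _ _ iD') (_ : hD' \o _ = hD' \o pc); last first.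
    by apply/funext => i /=; rewrite hDK.
  exact: (centre_code_dom F2).
have zE : tuple_mx (z ord0) = 1%:M +
      (p (t first last) (mxvec_index first last) * 4 * x) *: delta_mx first last <->
    normal (tuple_mx (z ord0)) /\ decode_matrix (z ord0) = tau (u * x).
  rewrite uP -(mat_tau _ F2); split=> [E|[nz <-]]; last by rewrite eq_eltK.
  by split; [rewrite E; apply: mat_normal | rewrite /decode_matrix E matK].
rewrite zE; split=> [[nz zx]|[zc zzc /h0P[/domE[s sE]]]].
  exists (fun=> hD (tau (u * x))).
    by move=> i; rewrite [i]ord1; apply/hDP; rewrite matrix_code_dom.
  apply/h0P; rewrite domE hDK; split; first by exists (u * x).
  by rewrite /decode_centre /= hDK (tauK _ F2) mulrC mulKf.
have := zzc ord0; rewrite -[zc ord0]hD'K => /hDP[/matrix_code_dom nz ->] xE.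
by split=> //; rewrite -xE /decode_centre /= sE (tauK _ F2) mulrC divfK.
Qed.

End BiInterpretation.

Theorem lemma5p3 (n : nat) (F : fieldType) :
  (3 <= n)%N ->
  infinite_set [set: F] ->
  2%N \notin [pchar F] ->
  regularly_bi_interpretable_wrt
    (group_structure (proj_triangular n F))
    (ring_structure F)
    (tnth (in_tuple (T_star_bar n F))).
Proof.
case: n => [|[|m]] // _ _ F2; set c := tnth _.
have c_onto (x : triangular m.+2 F) : x \in T_star m.+2 F -> exists i, c i = cquot x.
  by move=> /(map_f (@cquot _))/seq_tnthP[i ->]; exists i.
have /choice[d dP] i : exists s, c s = cquot (d_elt F i).
  by apply: c_onto; rewrite mem_cat codom_f orbT.
have /choice[t' tP] (ij : 'I_m.+2 * 'I_m.+2) : exists s,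
    forall lt_ij : (ij.1 < ij.2)%N, c s = cquot (t_elt F (exist _ ij lt_ij)).
  have [lt_ij|ge_ij] := pselect (ij.1 < ij.2)%N; last by exists (d ord0).
  have [|s sE] := c_onto (t_elt F (exist _ ij lt_ij)).
    by rewrite mem_cat codom_f.
  by exists s => lt_ij'; rewrite (bool_irrelevance lt_ij' lt_ij).
pose t i j := t' (i, j).
have cc : coordinates t d c.
  by apply: coordinates_star => // i j ij; apply: (tP (i, j)).
exists 0, (matrix_code m F), trivial_formula, (centre_code F t).
exists (coordinates_formula F t d); split.
- exact: matrix_regular.
- exact: centre_regular cc.
- exact: group_definable_iso.
- exact: field_definable_iso.
- exact/formula_ofP.
Qed.
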